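(* Let $X_1, X_2, \ldots, X_n, \ldots$ be countably many non-empty Noetherian spaces. 1. If $||X_n||$ is infinite for infinitely many values of $n$, then $||\mathop{\triangleright}_{n=1}^{+\infty} X_n|| = \bigotimes_{n=1}^{+\infty} ||X_n||$. 2. If $||X_n||$ is finite for $n$ large enough, then letting $k$ be the largest index such that $||X_k||$ is infinite, or $0$ if there is none, $||\mathop{\triangleright}_{n=1}^{+\infty} X_n||$ is equal to $\left(\bigotimes_{m=1}^k ||X_m||\right) \times \omega$.
   Context: A topological space is Noetherian if every open subset is compact (every open cover has a finite subcover; no separation is required). For a well-founded poset $P$ and $x \in P$, $\mathrm{rk}_P(x) = \sup_{x' < x} (\mathrm{rk}_P(x')+1)$ and the ordinal rank of $P$ is $|P| = \sup_{x \in P} (\mathrm{rk}_P(x)+1)$, where $\sup\emptyset = 0$. $\mathcal{H}_0 X$ is the poset of all closed subsets of $X$ (including $\emptyset$), ordered by inclusion; it is well-founded when $X$ is Noetherian. The stature of a Noetherian space $X$ is $||X|| = |\mathcal{H}_0 X| - 1$, equivalently $||X|| = \mathrm{rk}_{\mathcal{H}_0 X}(X)$. The space $\mathop{\triangleright}_{n=1}^{+\infty} X_n$ of heterogeneous words is the set of all tuples $w = x_1 x_2 \cdots x_m \in X_1 \times \cdots \times X_m$, with $m \in \mathbb{N}$ arbitrary (including the empty tuple $\epsilon$, $m=0$); $|w| = m$ is the length of $w$. It has the prefix topology, defined as follows. A telescope is a sequence $\mathcal{U} = U_0, U_1, \ldots, U_n, \ldots$ where $U_n$ is open in $\prod_{i=1}^n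 X_i$ for each $n \in \mathbb{N}$ (with $\prod_{i=1}^0 X_i = \{\epsilon\}$) and $U_n \times X_{n+1} \subseteq U_{n+1}$ for every $n \in \mathbb{N}$. It is a wide telescope if $U_n = \prod_{i=1}^n X_i$ for some $n \in \mathbb{N}$. The open sets of the prefix topology are the empty set and all the sets $\lfloor \mathcal{U} \rfloor = \{w \mid w \in U_{|w|}\}$, where $\mathcal{U}$ is a wide telescope. This space is Noetherian when all $X_n$ are. $\otimes$ is the natural (Hessenberg) product of ordinals, an empty natural product is $1$, and for non-zero ordinals $\alpha_n$, $\bigotimes_{n=1}^{+\infty} \alpha_n$ is the least upper bound of the ordinals $\bigotimes_{i=1}^n \alpha_i$, $n \in \mathbb{N}$. The operation $\times$ between ordinals is ordinary ordinal multiplication ($\alpha \times \omega = \sup_{n \in \mathbb{N}} \alpha \times n$). *)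

(* Defs.v *)
From HB Require Import structures.
From mathcomp Require Import all_boot all_order finmap.
From mathcomp Require Import mathcomp_extra boolp classical_sets functions.
From mathcomp Require Import cardinality filter topology.

Set Implicit Arguments.
Unset Strict Implicit.
Unset Printing Implicit Defensive.

Local Open Scope classical_set_scope.

(* Ordinals are well-founded trees: olsup f is the least strict upper bound
   sup_a (f a + 1).  Classically, ole is a total well-founded preorder, and
   ordinals are compared by =o, i.e. up to the equivalence it induces. *)
Inductive ord : Type := olsup (A : Type) (f : A -> ord).

Definition odom (a : ord) : Type := let: olsup A _ := a in A.
Definition ochild (a : ord) : odom a -> ord :=
  match a with olsup _ f => f end.

Fixpoint ole (a b : ord) : Prop :=
  match a with
  | olsup A f => forall x : A,
      match b with olsup B g => exists y : B, ole (f x) (g y) end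
  end.

Definition olt (a b : ord) : Prop := exists y : odom b, ole a (ochild y).
Definition oeq (a b : ord) : Prop := ole a b /\ ole b a.

Declare Scope ord_scope.
Delimit Scope ord_scope with ord.
Notation "a <=o b" := (ole a b) (at level 70, no associativity) : ord_scope.
Notation "a <o b" := (olt a b) (at level 70, no associativity) : ord_scope.
Notation "a =o b" := (oeq a b) (at level 70, no associativity) : ord_scope.
Local Open Scope ord_scope.

Definition osup (A : Type) (f : A -> ord) : ord :=
  olsup (fun p : {x : A & odom (f x)} => ochild (projT2 p)).

Arguments osup : simpl never.

Definition ozero : ord := olsup (of_void ord).
Definition osucc (a : ord) : ord := olsup (fun _ : unit => a).
Definition onat (n : nat) : ord := iter n osucc ozero.
Definition oone : ord := onat 1.
Definition omega : ord := olsup onat.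

Definition ofinite (a : ord) : Prop := exists n : nat, a =o onat n.

(* a - 1, for a successor a; it is a itself if a is 0 or a limit *)
Definition opred (a : ord) : ord := osup (@ochild a).

Fixpoint oadd (a b : ord) : ord :=
  match b with
  | olsup B g => olsup (fun s : odom a + B =>
      match s with inl x => ochild x | inr y => oadd a (g y) end)
  end.

Fixpoint omul (a b : ord) : ord :=
  match b with olsup B g => osup (fun y : B => oadd (omul a (g y)) a) end.

(* omega ^ a *)
Fixpoint opow (a : ord) : ord :=
  match a with
  | olsup A f => osup (fun s : option A =>
      if s is Some x then omul (opow (f x)) omega else oone)
  end.

(* path.sorted and path.sort cannot be used at type ord: they are confined to
   a universe below that of ord, which is above that of topologicalType *)
Fixpoint nonincreasing (s : seq ord) : Prop :=
  match s with
  | a :: (b :: _) as s' => b <=o a /\ nonincreasing s'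
  | _ => True
  end.

Fixpoint oinsert (a : ord) (s : seq ord) : seq ord :=
  if s is b :: s' then if `[< b <=o a >] then a :: s else b :: oinsert a s'
  else [:: a].
Definition osort (s : seq ord) : seq ord := foldr oinsert [::] s.

Definition cnf_val (s : seq ord) : ord :=
  foldr (fun a v => oadd (opow a) v) ozero s.
Definition is_cnf (a : ord) (s : seq ord) : Prop :=
  nonincreasing s /\ cnf_val s =o a.

Lemma ole_refl a : a <=o a.
Proof. by elim: a => A f IH /= x; exists x. Qed.
Hint Resolve ole_refl : core.

Lemma ole_trans b a c : a <=o b -> b <=o c -> a <=o c.
Proof.
elim: a b c => A f IH [B g] [C h] /= ab bc x.
have [y xy] := ab x; have [z yz] := bc y.
by exists z; apply: IH xy yz.
Qed.

Lemma oleP a b : a <=o b <-> forall x : odom a, ochild x <o b.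
Proof. by case: a b => [A f] [B g]. Qed.

Lemma olt_child a (x : odom a) : ochild x <o a.
Proof. by exists x. Qed.

Lemma ole_lt_trans b a c : a <=o b -> b <o c -> a <o c.
Proof. by move=> ab [y by_]; exists y; apply: ole_trans ab by_. Qed.

Lemma olt_le_trans b a c : a <o b -> b <=o c -> a <o c.
Proof. by move=> [y ay] /oleP bc; apply: ole_lt_trans ay (bc y). Qed.

Lemma olt_wf : well_founded olt.
Proof.
move=> a; suff: forall b, b <=o a -> Acc olt b by apply.
elim: a => A f IH b ba; constructor => c cb.
by have [y cy] := olt_le_trans cb ba; apply: (IH y).
Qed.

Lemma olt_irr a : ~ a <o a.
Proof. by elim/(well_founded_ind olt_wf): a => a IH aa; exact: (IH a aa). Qed.

Lemma oltW a b : a <o b -> a <=o b.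
Proof.
elim: a b => A f IH b [y ay]; apply/oleP => x.
by exists y; apply/IH; apply: olt_le_trans ay; exists x.
Qed.

Lemma ole_total a b : a <=o b \/ b <o a.
Proof.
elim: a b => A f IH b.
have [[x bx]|n] := pselect (exists x, b <=o f x); first by right; exists x.
left; apply/oleP => /= x.
have [//|lt] := pselect (f x <o b).
case: n; exists x; apply/oleP => y; have [le|//] := IH x (ochild y).
by case: lt; exists y; exact: le.
Qed.

Lemma osup_ub A (f : A -> ord) x : f x <=o osup f.
Proof. by apply/oleP => y; exists (existT _ x y). Qed.

Lemma osup_lub A (f : A -> ord) b : (forall x, f x <=o b) -> osup f <=o b.
Proof. by move=> fb; apply/oleP => -[x y]; move/oleP: (fb x); apply. Qed.

Lemma olt_osup A (f : A -> ord) b : b <o osup f -> exists x, b <o f x.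
Proof. by move=> [[x y] /= h]; exists x; exists y. Qed.

Lemma olt_succ a b : a <o osucc b <-> a <=o b.
Proof. by split => [[[] h]|h] //; exists tt. Qed.

Lemma oadd_mono a a' b b' : a <=o a' -> b <=o b' -> oadd a b <=o oadd a' b'.
Proof.
elim: b b' => B g IH [B' g'] aa' bb'; apply/oleP => -[x|y] /=.
  by move/oleP: aa' => /(_ x) [x' h]; exists (inl x').
by have [y' h] := bb' y; exists (inr y'); apply: IH.
Qed.

Lemma oadd_assoc a b c : oadd (oadd a b) c <=o oadd a (oadd b c).
Proof.
elim: c => C h IH; case: b IH => B g IH; apply/oleP => -[[x|y]|z] /=.
- by exists (inl x).
- by exists (inr (inl y)).
- by exists (inr (inr z)); apply: IH.
Qed.

Lemma omul_mono a a' b : a <=o a' -> omul a b <=o omul a' b.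
Proof.
move=> aa'; elim: b => B g IH; apply: osup_lub => y.
by apply: ole_trans (osup_ub _ y); apply: oadd_mono.
Qed.

Lemma omul_omega_ge a : a <=o omul a omega.
Proof.
have := osup_ub (fun n => oadd (omul a (onat n)) a) 0; apply: ole_trans.
case: a => A f; apply/oleP => x; exists (inr x) => /=.
elim: (f x) => C h IH; apply/oleP => z; exists (inr z); exact: IH.
Qed.

Lemma opow_ge1 a : oone <=o opow a.
Proof. by case: a => A f; apply: osup_ub None. Qed.

Lemma opow_lt a b : a <o b -> omul (opow a) omega <=o opow b.
Proof.
elim: a b => A f IH [B g] [y ay].
apply: ole_trans (osup_ub _ (Some y)); apply: omul_mono; apply: osup_lub.
case=> [x|]; last exact: opow_ge1.
by apply: IH; apply: olt_le_trans ay; exists x.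
Qed.

Lemma opow_self a : a <o opow (osucc a).
Proof.
elim: a => A f IH.
apply: (@ole_lt_trans (opow (olsup f))).
  apply/oleP => x; apply: olt_le_trans (IH x) _.
  apply: osup_lub => -[[]|]; last exact: opow_ge1.
  exact: (osup_ub _ (Some x)).
apply: (@olt_le_trans (omul (opow (olsup f)) omega)); last first.
  exact: (osup_ub _ (Some tt)).
apply: (@olt_le_trans (oadd (omul (opow (olsup f)) (onat 1)) (opow (olsup f)))).
  set p := opow _.
  have h : ozero <o p by apply: olt_le_trans (opow_ge1 _); exists tt.
  have [y hy] := h; apply: (@ole_lt_trans (oadd p (@ochild p y))); last first.
    apply: (@olt_le_trans (oadd p p)); last first.
      apply: oadd_mono => //.
      apply: ole_trans (osup_ub (fun _ : unit => oadd (omul p ozero) p) tt).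
      case: (p) => P k; apply/oleP => x; exists (inr x) => /=.
      by elim: (k x) => C l IHl; apply/oleP => z; exists (inr z); exact: IHl.
    by case: (p) y {hy} => P k /= y; exists (inr y).
  by case: (@ochild p y) => C l; apply/oleP => x; exists (inl x).
exact: (osup_ub (fun n => oadd (omul (opow (olsup f)) (onat n)) _) 1).
Qed.

Lemma ord_least (P : ord -> Prop) :
  (exists a, P a) -> exists2 a, P a & forall b, P b -> a <=o b.
Proof.
move=> [a]; elim/(well_founded_ind olt_wf): a => a IH Pa.
have [[b [ba Pb]]|n] := pselect (exists b, b <o a /\ P b); first exact: IH Pb.
exists a => // b Pb; have [//|ba] := ole_total a b.
by case: n; exists b.
Qed.

Lemma osubP d a : d <=o a -> exists r, oadd d r =o a.
Proof.
move=> da; have [|r ar rmin] := @ord_least (fun r => a <=o oadd d r).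
  exists a; elim: {da} a => A f IH; apply/oleP => x; exists (inr x); exact: IH.
exists r; split=> //; case: r ar rmin => B g _ rmin; apply/oleP => -[x|y] /=.
  by move/oleP: da; apply.
have [h|//] := ole_total a (oadd d (g y)).
by have /olt_irr := olt_le_trans (olt_child (a := olsup g) y) (rmin _ h).
Qed.

Lemma cnf_exists a : exists s, is_cnf a s.
Proof.
elim/(well_founded_ind olt_wf): a => a IH.
have [a0|a_gt0] := ole_total a ozero; first by exists [::]; do !split=> //; case.
have [|c ac cmin] := @ord_least (fun c => a <o opow c).
  by exists (osucc a); exact: opow_self.
have [b [ba ab]] : exists b, opow b <=o a /\ a <o omul (opow b) omega.
  case: c ac cmin => C f ac cmin; have [[x|] h] := olt_osup ac.
    exists (f x); split=> //; have [//|/cmin le] := ole_total (opow (f x)) a.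
    by have /olt_irr := olt_le_trans (olt_child (a := olsup f) x) le.
  by have /olt_irr := olt_le_trans a_gt0 (proj1 (olt_succ _ _) h).
have [r [ra ar]] := osubP ba.
have r_lt : r <o a.
  have [le|//] := ole_total a r.
  have dn n : oadd (omul (opow b) (onat n)) a <=o a.
    elim: n => [|n IHn].
      elim: (a) => A f IHa; apply/oleP => -[[[]]//|x]; exists x; exact: IHa.
    apply: ole_trans IHn; apply: (@ole_trans
        (oadd (oadd (omul (opow b) (onat n)) (opow b)) a)).
      by apply: oadd_mono => //; apply: osup_lub => -[].
    apply: ole_trans (oadd_assoc _ _ _) _; apply: oadd_mono => //.
    by apply: ole_trans ra; apply: oadd_mono.
  have /olt_irr[] : a <o a.
  apply: olt_le_trans ab _; apply: osup_lub => n.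
  by apply: ole_trans (dn n); apply: oadd_mono.
have [s [ss sr]] := IH _ r_lt; exists (b :: s); split; last first.
  have [s1 s2] := sr; split.
    by apply: ole_trans ra; apply: oadd_mono.
  by apply: ole_trans ar _; apply: oadd_mono.
case: s ss sr => //= b' s ss [sr _]; split=> //.
have [//|/opow_lt h] := ole_total b' b.
have /olt_irr[] : a <o a.
apply: olt_le_trans ab _; apply: ole_trans h _.
apply: ole_trans (oltW r_lt); apply: ole_trans sr.
move: (opow b') (cnf_val s) => p q; case: q => Q k.
by apply/oleP => x; exists (inl x).
Qed.

(* exponents of the Cantor normal form omega^a_1 + ... + omega^a_m,
   a_1 >= ... >= a_m *)
Definition cnf (a : ord) : seq ord := projT1 (cid (cnf_exists a)).

(* Hessenberg sum and product *)
Definition nadd (a b : ord) : ord := cnf_val (osort (cnf a ++ cnf b)).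
Definition nmul (a b : ord) : ord :=
  cnf_val (osort [seq nadd x y | x <- cnf a, y <- cnf b]).

Definition nprod (a : nat -> ord) (n : nat) : ord :=
  \big[nmul/oone]_(i < n) a i.
Definition infinite_nprod (a : nat -> ord) : ord := osup (nprod a).

(* With a numbered from 0: 1 + the largest j with a j infinite, 0 if none *)
Definition last_infinite (a : nat -> ord) (k : nat) : Prop :=
  (k = 0 /\ forall n, ofinite (a n)) \/
  (exists j, [/\ k = j.+1, ~ ofinite (a j)
                & forall n, (j < n)%N -> ofinite (a n)]).

(* rk_P(x) for the strict order lt; the value is 0 if lt is not well-founded *)
Definition rk (T : Type) (lt : T -> T -> Prop) : T -> ord :=
  match pselect (well_founded lt) with
  | left wf => Fix wf (fun _ => ord)
      (fun x rec => olsup (fun y : {y | lt y x} => rec (sval y) (svalP y)))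
  | right _ => fun _ => ozero
  end.

Definition ord_rank (T : Type) (lt : T -> T -> Prop) : ord := olsup (rk lt).

Lemma rkE (T : Type) (lt : T -> T -> Prop) x : well_founded lt ->
  rk lt x = olsup (fun y : {y | lt y x} => rk lt (sval y)).
Proof.
move=> wf; rewrite /rk; case: pselect => // wf'; rewrite Fix_eq //.
by move=> {}x f g fg; congr olsup; apply/funext => -[y h] /=.
Qed.

Definition noetherian (X : topologicalType) : Prop :=
  forall U : set X, open U -> cover_compact U.

Definition hoare (X : topologicalType) : Type := {C : set X | closed C}.
Definition hoare_lt (X : topologicalType) (C D : hoare X) : Prop :=
  sval C `<` sval D.

Definition stature (X : topologicalType) : ord :=
  opred (ord_rank (@hoare_lt X)).

Lemma noetherian_wf (X : topologicalType) :
  noetherian X -> well_founded (@hoare_lt X).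
Proof.
move=> nX C0; apply: contrapT => nC0.
pose S := {C : hoare X | ~ Acc (@hoare_lt X) C}.
have step (C : S) : {D : S | hoare_lt (sval D) (sval C)}.
  case: C => C nC; apply: cid; apply: contrapT => h; apply: (nC).
  constructor => D DC; apply: contrapT => nD; apply: h.
  by exists (exist _ D nD).
pose u n : S := iter n (fun C => sval (step C)) (exist _ C0 nC0).
pose V n := ~` sval (sval (u n)).
have uS n : hoare_lt (sval (u n.+1)) (sval (u n)) by exact: (svalP (step (u n))).
have Vmon m n : (m <= n)%N -> V m `<=` V n.
  move=> /subnK <-; elim: (n - m)%N => [//|k IHk].
  apply: subset_trans IHk _; rewrite addSn; apply: subsetC.
  by case: (uS (k + m)).
have oV n : open (V n) by apply: closed_openC; exact: (svalP (sval (u n))).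
have oU : open (\bigcup_n V n) by apply: bigcup_open.
have [|D _ sub] := nX _ oU nat setT V (fun n _ => oV n); first by [].
pose N := \max_(i <- D) i.
have [_ []] := uS N; apply: subsetC2.
move=> x Vx; have [|i /= iD Vi] := sub x; first by exists N.+1.
by apply: Vmon Vi; apply: leq_bigmax_seq.
Qed.

Lemma stature_rk (X : topologicalType) : noetherian X ->
  stature X =o rk (@hoare_lt X) (exist _ setT closedT).
Proof.
move=> /noetherian_wf wf; split; last exact: osup_ub.
apply: osup_lub => -[C cC] /=; rewrite !rkE //; apply/oleP => -[D DC] /=.
suff DT : hoare_lt D (exist _ setT closedT) by exists (exist _ D DT).
by split=> // TD; case: DC => _; apply=> x _; apply: TD.
Qed.

Section heterogeneous_words.
Variable X : nat -> topologicalType.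

(* With letters numbered from 0, wordn n is X 0 * ... * X n.-1 *)
Definition wordn (n : nat) : topologicalType :=
  prod_topology (fun i : 'I_n => X i).

Definition belast_word (n : nat) (w : wordn n.+1) : wordn n :=
  fun i => w (widen_ord (leqnSn n) i).

Definition telescope (U : forall n, set (wordn n)) : Prop :=
  (forall n, open (U n)) /\
  (forall n (w : wordn n.+1), U n (belast_word w) -> U n.+1 w).

Definition wide_telescope (U : forall n, set (wordn n)) : Prop :=
  telescope U /\ exists n, U n = setT.

Record hword : Type := HWord { hlen : nat; hletters : wordn hlen }.
Arguments hletters h : clear implicits.

Definition tfloor (U : forall n, set (wordn n)) : set hword :=
  [set w | U (hlen w) (hletters w)].

Definition prefix_open (A : set hword) : Prop :=
  A = set0 \/ exists2 U, wide_telescope U & A = tfloor U.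

HB.instance Definition _ := gen_eqMixin hword.
HB.instance Definition _ := gen_choiceMixin hword.

Lemma telescope_wide U m n : telescope U -> (m <= n)%N ->
  U m = setT -> U n = setT.
Proof.
move=> [_ tU] /subnK <- Um; elim: (n - m)%N => // k IHk.
by rewrite -subTset => w _; apply: tU; rewrite IHk.
Qed.

Lemma prefix_openT : prefix_open setT.
Proof.
right; exists (fun=> setT) => //; split; last by exists 0.
by split=> // n; exact: openT.
Qed.

Lemma prefix_openI : setI_closed prefix_open.
Proof.
move=> A B [->|[U [tU [m Um]] ->]]; first by rewrite set0I; left.
move=> [->|[V [tV [n Vn]] ->]]; first by rewrite setI0; left.
right; exists (fun n => U n `&` V n) => //; split; first split.
- by move=> k; apply: openI; [apply: tU.1|apply: tV.1].
- by move=> k w [Uw Vw]; split; [apply: tU.2|apply: tV.2].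
- exists (maxn m n); rewrite (telescope_wide tU (leq_maxl m n) Um).
  by rewrite (telescope_wide tV (leq_maxr m n) Vn) setIT.
Qed.

Lemma prefix_open_bigcup (I : Type) (F : I -> set hword) :
  (forall i, prefix_open (F i)) -> prefix_open (\bigcup_i F i).
Proof.
move=> oF; have [[i0 [U0 wU0 FU0]]|n] :=
  pselect (exists i, exists2 U, wide_telescope U & F i = tfloor U); last first.
  left; apply: bigcup0 => i _; case: (oF i) => // h.
  by case: n; exists i.
right; pose W := [set U | wide_telescope U /\ exists i, F i = tfloor U].
exists (fun n => \bigcup_(U in W) U n); first split; first split.
- by move=> n; apply: bigcup_open => U [[[oU _] _] _].
- by move=> n w [U WU Uw]; exists U => //; apply: WU.1.1.2.
- have [_ [n Un]] := wU0; exists n; rewrite -subTset => w _.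
  by exists U0; [split=> //; exists i0|rewrite Un].
rewrite eqEsubset; split=> w.
  move=> [i _ Fw]; case: (oF i) => [F0|[U wU FU]]; first by rewrite F0 in Fw.
  by exists U; [split=> //; exists i|rewrite FU in Fw].
by move=> [U [_ [i FU]] Uw]; exists i => //; rewrite FU.
Qed.

HB.instance Definition _ := isOpenTopological.Build hword
  prefix_openT prefix_openI prefix_open_bigcup.

Lemma open_hwordE : @open hword = prefix_open.
Proof. by []. Qed.

End heterogeneous_words.

(* Main.v *)
Require Import Defs.
From mathcomp Require Import all_boot all_order.
From mathcomp Require Import boolp classical_sets functions cardinality.
From mathcomp Require Import filter topology.
From Stdlib Require Setoid RelationClasses List.
From Stdlib Require Morphisms.

Set Implicit Arguments.
Unset Strict Implicit.
Unset Printing Implicit Defensive.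

Local Open Scope classical_set_scope.
Local Open Scope ord_scope.

(** A proper closed set of words is a prefix-closed family of words of bounded
    length, so it is a finite sequence of closed sets C_0, ..., C_{n-1} with
    C_m closed in the space of words of length m. Let P_m be the rank of that
    last space. The sets T_n of words of length less than n are closed, and
    T_{n+1} minus T_n is a copy of the space of words of length n; hence

      rank T_n + P_n <= rank T_{n+1} <= rank T_n (Hessenberg +) P_n,

    and the stature of the space of words is the supremum of the ranks of the
    T_n ([rank_shorterS_ge], [rank_shorterS_le], [rank_hword_leP]).
    Both cases follow by comparing with omega^(e+1), where e is the leading
    exponent of some P_n: an ordinal omega^c is closed under Hessenberg sums, so
    rank T_n < omega^(e+1) as soon as the P_i, i < n, are. When the statures of
    the letter spaces are finite from k on, all P_n stay below
    omega^(e+1) = omega^e * omega with e the leading exponent of P_k, while the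
    left inequality makes the rank of T_{k+n} at least P_k * n. When
    infinitely many statures are infinite, the next infinite factor already
    brings P_m to omega^(e+1) or more.

    What remains is that P_n is the Hessenberg product of the statures of the
    letter spaces, that is, that the rank of a product of two spaces is the
    Hessenberg product of their ranks ([rank_product]). All ranks are taken in
    one space: the rank of an arbitrary subset S is its rank among the traces of
    closed sets on S. These ranks are subadditive for Hessenberg sums
    ([rank_setU]) and superadditive for ordinary sums along a closed subset
    ([rank_closed_add]), and every smaller ordinal is the rank of a closed part
    ([rank_hit]).
    - Upper bound: cut each factor into pieces of ranks omega^a_i, following
      its Cantor normal form. For sides of ranks omega^a and omega^b, a proper
      closed subset of a box lies in two strips, the ranks of which are
      smaller than omega^(a (+) b) by induction ([rank_box_opow]).
    - Lower bound: by induction on the box, with Conway's recursive description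
      of the Hessenberg product ([olt_hmul]) and the supermodularity of
      ranks ([rank_supermodular]), which holds because closed sets form a
      distributive lattice ([rank_box_ge]).

    The Hessenberg sum is handled through its recursive description [hadd],
    for which commutativity, associativity and strict monotonicity are
    immediate; [nadd_hadd] and [nmul_hmul] relate it to sums and products of
    Cantor normal forms. *)

(** * Order and equivalence of ordinals *)

#[local] Hint Resolve ole_refl : core.

Lemma oeq_refl a : a =o a. Proof. by []. Qed.
Lemma oeq_sym a b : a =o b -> b =o a. Proof. by case. Qed.
Lemma oeq_trans b a c : a =o b -> b =o c -> a =o c.
Proof.
by move=> [ab ba] [bc cb]; split; [exact: ole_trans bc|exact: ole_trans ba].
Qed.
#[local] Hint Resolve oeq_refl : core.

Local Notation compat2 R S T :=
  (Morphisms.Proper (Morphisms.respectful R (Morphisms.respectful S T))).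

#[local] Instance oeq_equivalence : RelationClasses.Equivalence oeq.
Proof.
by split; [exact: oeq_refl|exact: oeq_sym|move=> a b c; exact: oeq_trans].
Qed.

#[local] Instance ole_proper : compat2 oeq oeq iff ole.
Proof.
move=> a a' [aa' a'a] b b' [bb' b'b]; split=> h.
  exact: ole_trans a'a (ole_trans h bb').
exact: ole_trans aa' (ole_trans h b'b).
Qed.

#[local] Instance olt_proper : compat2 oeq oeq iff olt.
Proof.
move=> a a' [aa' a'a] b b' [bb' b'b]; split=> h.
  exact: ole_lt_trans a'a (olt_le_trans h bb').
exact: ole_lt_trans aa' (olt_le_trans h b'b).
Qed.

Lemma ole_notlt a b : a <=o b <-> ~ b <o a.
Proof.
split=> [ab /olt_le_trans /(_ ab)|]; first exact: olt_irr.
by case: (ole_total a b).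
Qed.

Lemma ole_ltP a b : (forall c, c <o a -> c <o b) -> a <=o b.
Proof. by move=> h; apply/oleP => x; apply: h; exact: olt_child. Qed.

Lemma ole0 a : ozero <=o a.
Proof. by apply/oleP => -[]. Qed.
#[local] Hint Resolve ole0 : core.

Lemma olt1 a : a <o oone <-> a <=o ozero.
Proof. exact: olt_succ. Qed.

Lemma ole1 a : oone <=o a <-> ozero <o a.
Proof.
by split=> [/oleP/(_ tt)|h]; last by apply/oleP => -[].
Qed.

Lemma oltn0 a : ~ a <o ozero.
Proof. by case; case. Qed.

(** * Ordinal addition *)

Lemma olt_addP c a b :
  c <o oadd a b <-> c <o a \/ exists2 b', b' <o b & c <=o oadd a b'.
Proof.
case: b => B g; split.
  move=> [[x|y] /= h]; first by left; exists x.
  by right; exists (g y) => //; exact: (olt_child (a := olsup g)).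
move=> [[x h]|[b' [y /= b'y] h]]; first by exists (inl x).
by exists (inr y) => /=; apply: ole_trans h _; apply: oadd_mono.
Qed.

Lemma oadd_lt_r a b b' : b <o b' -> oadd a b <o oadd a b'.
Proof. by move=> h; apply/olt_addP; right; exists b. Qed.

Lemma oadd_ge_l a b : a <=o oadd a b.
Proof. by apply: ole_ltP => c ca; apply/olt_addP; left. Qed.

Lemma oadd_ge_r a b : b <=o oadd a b.
Proof.
elim: b => B g IH; apply/oleP => y /=.
by exists (inr y); exact: IH.
Qed.

Lemma oadd_cancel a b b' : oadd a b <=o oadd a b' -> b <=o b'.
Proof.
move=> h; apply/ole_notlt => /(oadd_lt_r a); apply/ole_notlt; exact: h.
Qed.

Lemma oadd0 a : oadd a ozero =o a.
Proof.
split; last exact: oadd_ge_l.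
by apply: ole_ltP => c /olt_addP[//|[b /oltn0]].
Qed.

Lemma add0o a : oadd ozero a =o a.
Proof.
split; last exact: oadd_ge_r.
elim: a => A f IH; apply/oleP => -[[]//|x] /=.
by exists x; exact: IH.
Qed.

Lemma oaddA a b c : oadd a (oadd b c) =o oadd (oadd a b) c.
Proof.
split; last exact: oadd_assoc.
elim: c => C h IH; case: b IH => B g IH; apply/oleP => -[x|[y|z]] /=.
- by exists (inl (inl x)).
- by exists (inl (inr y)).
- by exists (inr z); exact: IH.
Qed.

#[local] Instance oadd_proper : compat2 oeq oeq oeq oadd.
Proof. by move=> a a' [? ?] b b' [? ?]; split; exact: oadd_mono. Qed.

Lemma omul_natS a n : omul a (onat n.+1) =o oadd (omul a (onat n)) a.
Proof. by split; [apply: osup_lub|exact: (osup_ub (fun=> _) tt)]. Qed.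

Lemma omul_nat0 a : omul a (onat 0) =o ozero.
Proof. by split=> //; apply: osup_lub => -[]. Qed.

Lemma omul_natSl a n : omul a (onat n.+1) =o oadd a (omul a (onat n)).
Proof.
elim: n => [|n IH]; first by rewrite omul_natS omul_nat0 oadd0 add0o.
by rewrite omul_natS {1}IH -oaddA -omul_natS.
Qed.

Lemma omul_omegaP a b : omul a omega <=o b <-> forall n, omul a (onat n) <=o b.
Proof.
split=> h; last by apply: osup_lub => n; rewrite -omul_natS.
move=> n; apply: ole_trans h; apply: ole_trans (osup_ub _ n).
exact: oadd_ge_l.
Qed.

Lemma olt_mul_omega a c : c <o omul a omega -> exists n, c <o omul a (onat n).
Proof. by move=> /olt_osup[n h]; exists n.+1; rewrite omul_natS. Qed.

(** * Hessenberg addition *)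

(** The recursive description of the natural sum: a +h b is the least ordinal
    above all a' +h b and a +h b', for a' < a and b' < b. *)
Fixpoint hadd (a : ord) : ord -> ord :=
  match a with
  | olsup A f =>
    fix ha (b : ord) : ord :=
      match b with
      | olsup B g => olsup (fun s : A + B =>
          match s with inl x => hadd (f x) b | inr y => ha (g y) end)
      end
  end.
Local Notation "a +h b" := (hadd a b)
  (at level 50, left associativity) : ord_scope.

Lemma olt_haddP_child c a b : c <o a +h b <->
  (exists x : odom a, c <=o ochild x +h b) \/
  (exists y : odom b, c <=o a +h ochild y).
Proof.
case: a b => [A f] [B g]; split.
  by move=> [[x|y] h]; [left; exists x|right; exists y].
by move=> [[x h]|[y h]]; [exists (inl x)|exists (inr y)].
Qed.

Lemma hadd_mono a a' b b' : a <=o a' -> b <=o b' -> a +h b <=o a' +h b'.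
Proof.
elim: a a' b b' => A f IHa a' b.
elim: b => B g IHb b' aa' bb'; apply/oleP => -[x|y]; apply/olt_haddP_child.
  by left; have [x' h] := (proj1 (oleP _ _) aa') x; exists x'; exact: IHa.
by right; have [y' h] := (proj1 (oleP _ _) bb') y; exists y'; exact: IHb.
Qed.

#[local] Instance hadd_proper : compat2 oeq oeq oeq hadd.
Proof. by move=> a a' [? ?] b b' [? ?]; split; exact: hadd_mono. Qed.

Lemma hadd_lt_l a a' b : a <o a' -> a +h b <o a' +h b.
Proof.
by move=> [x ax]; apply/olt_haddP_child; left; exists x; exact: hadd_mono.
Qed.

Lemma hadd_lt_r a b b' : b <o b' -> a +h b <o a +h b'.
Proof.
by move=> [y b_y]; apply/olt_haddP_child; right; exists y; exact: hadd_mono.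
Qed.

Lemma olt_haddP c a b : c <o a +h b <->
  (exists2 a', a' <o a & c <=o a' +h b) \/
  (exists2 b', b' <o b & c <=o a +h b').
Proof.
split=> [/olt_haddP_child[[x h]|[y h]]|[[a' a'a h]|[b' b'b h]]].
- by left; exists (ochild x) => //; exact: olt_child.
- by right; exists (ochild y) => //; exact: olt_child.
- exact: ole_lt_trans h (hadd_lt_l _ a'a).
- exact: ole_lt_trans h (hadd_lt_r _ b'b).
Qed.

Lemma hadd_leP a b c : a +h b <=o c <->
  (forall a', a' <o a -> a' +h b <o c) /\ (forall b', b' <o b -> a +h b' <o c).
Proof.
split=> [h|[ha hb]].
  split=> x hx; apply: olt_le_trans h; first exact: hadd_lt_l.
  exact: hadd_lt_r.
apply: ole_ltP => d /olt_haddP[] [x hx hd]; apply: ole_lt_trans hd _.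
  exact: ha.
exact: hb.
Qed.

Lemma haddC a b : a +h b =o b +h a.
Proof.
suff h : forall a b, a +h b <=o b +h a by split; exact: h.
move=> {}a; elim/(well_founded_ind olt_wf): a => a IHa.
elim/(well_founded_ind olt_wf) => {}b IHb.
apply/hadd_leP; split=> x hx.
  by apply: ole_lt_trans (IHa _ hx b) _; exact: hadd_lt_r.
by apply: ole_lt_trans (IHb _ hx) _; exact: hadd_lt_l.
Qed.

Lemma hadd0 a : a +h ozero =o a.
Proof.
split.
  elim/(well_founded_ind olt_wf): a => a IH; apply/hadd_leP; split=> x.
    by move=> xa; exact: ole_lt_trans (IH _ xa) xa.
  by move/oltn0.
elim/(well_founded_ind olt_wf): a => a IH; apply: ole_ltP => c ca.
by apply: ole_lt_trans (IH _ ca) _; exact: hadd_lt_l.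
Qed.

Lemma add0h a : ozero +h a =o a.
Proof. by rewrite haddC hadd0. Qed.

Lemma haddA a b c : a +h (b +h c) =o a +h b +h c.
Proof.
suff h : forall a b c, a +h (b +h c) <=o a +h b +h c.
  split; first exact: h.
  rewrite haddC (haddC a b); apply: ole_trans (h _ _ _) _.
  by rewrite (haddC c b) haddC.
move=> {}a; elim/(well_founded_ind olt_wf): a => a IHa.
move=> {}b; elim/(well_founded_ind olt_wf): b => b IHb.
elim/(well_founded_ind olt_wf) => {}c IHc.
apply/hadd_leP; split=> [x xa|y].
  by apply: ole_lt_trans (IHa _ xa _ _) _; do 2!apply: hadd_lt_l.
move=> /olt_haddP[] [z hz hy].
  apply: ole_lt_trans (hadd_mono (ole_refl a) hy) _.
  apply: ole_lt_trans (IHb _ hz _) _.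
  by apply: hadd_lt_l; exact: hadd_lt_r.
apply: ole_lt_trans (hadd_mono (ole_refl a) hy) _.
by apply: ole_lt_trans (IHc _ hz) _; exact: hadd_lt_r.
Qed.

Lemma haddCA a b c : a +h (b +h c) =o b +h (a +h c).
Proof. by rewrite haddA (haddC a b) -haddA. Qed.

Lemma haddACA a b c d : (a +h b) +h (c +h d) =o (a +h c) +h (b +h d).
Proof. by rewrite -haddA (haddCA b) haddA. Qed.

Lemma hadd_ge_l a b : a <=o a +h b.
Proof. by rewrite -{1}[a]hadd0; exact: hadd_mono. Qed.

Lemma hadd_ge_r a b : b <=o a +h b.
Proof. by rewrite haddC; exact: hadd_ge_l. Qed.

Lemma hadd_cancel a b c : a +h c <=o b +h c -> a <=o b.
Proof. by move=> h; apply/ole_notlt => /(hadd_lt_l c); apply/ole_notlt. Qed.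

Lemma oadd_le_hadd a b : oadd a b <=o a +h b.
Proof.
elim/(well_founded_ind olt_wf): b => b IH; apply: ole_ltP => c /olt_addP[ca|].
  exact: olt_le_trans ca (hadd_ge_l _ _).
move=> [b' b'b h]; apply: ole_lt_trans h _; apply: ole_lt_trans (IH _ b'b) _.
exact: hadd_lt_r.
Qed.

(* These fixpoints would unfold on constants such as ozero. *)
#[local] Arguments hadd : simpl never.
#[local] Arguments oadd : simpl never.
#[local] Arguments omul : simpl never.
#[local] Arguments opow : simpl never.

(** * Powers of omega and Cantor normal forms *)

Lemma opow_mono a b : a <=o b -> opow a <=o opow b.
Proof.
case: a => A f ab; apply: osup_lub => -[x|]; last exact: opow_ge1.
by apply: opow_lt; move/oleP: ab; apply.
Qed.

#[local] Instance opow_proper :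
  Morphisms.Proper (Morphisms.respectful oeq oeq) opow.
Proof. by move=> a b [ab ba]; split; exact: opow_mono. Qed.

Lemma opow_gt0 a : ozero <o opow a.
Proof. by apply/ole1; exact: opow_ge1. Qed.
#[local] Hint Resolve opow_gt0 : core.

Lemma opow0 : opow ozero =o oone.
Proof. by split; [apply: osup_lub => -[[]|]|exact: opow_ge1]. Qed.

Lemma omul_nat_lt a n : ozero <o a -> omul a (onat n) <o omul a (onat n.+1).
Proof.
by move=> a0; rewrite omul_natS -[X in X <o _]oadd0; exact: oadd_lt_r.
Qed.

Lemma omul_nat_lt_omega a n : ozero <o a -> omul a (onat n) <o omul a omega.
Proof.
move=> /(omul_nat_lt n) /olt_le_trans; apply.
exact: (proj1 (omul_omegaP a _) (ole_refl _)).
Qed.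

Lemma opow_strict a b : a <o b -> opow a <o opow b.
Proof.
move=> /opow_lt; apply: olt_le_trans; have := omul_nat_lt_omega 1 (opow_gt0 a).
by rewrite omul_natS omul_nat0 add0o.
Qed.

Lemma opow_lt_inv a b : opow a <o opow b -> a <o b.
Proof. by have [/opow_mono/ole_notlt|//] := ole_total b a. Qed.

Lemma opowS a : opow (osucc a) =o omul (opow a) omega.
Proof.
split; last exact: (osup_ub _ (Some tt)).
apply: osup_lub => -[x//|]; apply: ole_trans (opow_ge1 a) _.
exact: omul_omega_ge.
Qed.

Lemma olt_opow x a : x <o opow a ->
  x <=o ozero \/ exists2 d, d <o a & exists n, x <=o omul (opow d) (onat n).
Proof.
case: a => A f /olt_osup[[i|] h]; last by left; exact/olt1.
right; exists (f i); first exact: (olt_child (a := olsup f)).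
by have [n hn] := olt_mul_omega h; exists n; exact: oltW.
Qed.

Definition opow_closed a := forall x y,
  x <o opow a -> y <o opow a -> x +h y <o opow a.

(** Ordinary addition loses the terms on the left that the right summand
    absorbs, which the Hessenberg sum keeps; but a power of omega is not
    absorbed by ordinals of its own order of magnitude. The closure assumption is discharged below, by an induction on
    the exponent that alternates between the two lemmas. *)
Lemma hadd_opow_of_closed a n y : opow_closed a ->
  y <=o omul (opow a) (onat n) -> opow a +h y <=o oadd (opow a) y.
Proof.
move=> Ha; elim/(well_founded_ind olt_wf): y => y IH yn.
apply/hadd_leP; split=> [x xa|y' y'y]; last first.
  apply: ole_lt_trans (oadd_lt_r _ y'y); apply: IH => //.
  exact: ole_trans (oltW y'y) yn.
have [ay|ya] := ole_total (opow a) y; last first.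
  by apply: olt_le_trans (Ha _ _ xa ya) (oadd_ge_l _ _).
have [z zy] := osubP ay.
have z_lt : z <o y.
  have [yz|//] := ole_total y z.
  (* if y <= z, then y absorbs every multiple of omega^a on its left *)
  have big m : oadd (omul (opow a) (onat m)) y <=o y.
    elim: m => [|m IHm]; first by rewrite omul_nat0 add0o.
    apply: ole_trans IHm; rewrite omul_natS -oaddA; apply: oadd_mono => //.
    by rewrite -{2}zy; exact: oadd_mono.
  have /olt_irr[] : y <o y.
  apply: ole_lt_trans yn _; apply: olt_le_trans (omul_nat_lt n (opow_gt0 a)) _.
  by apply: ole_trans (big n.+1); exact: oadd_ge_l.
have IHz : opow a +h z <=o y.
  rewrite -[y in X in _ <=o X]zy; apply: IH => //.
  exact: ole_trans (oltW z_lt) yn.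
(* As y = omega^a + z, moving x across omega^a gives
   x +h y <= omega^a +h (x +h z), where x +h z is below y. *)
have w_lt : x +h z <o y by apply: olt_le_trans IHz; exact: hadd_lt_l.
apply: (@ole_lt_trans (opow a +h (x +h z))).
  rewrite haddCA; apply: hadd_mono => //; rewrite -zy; exact: oadd_le_hadd.
apply: ole_lt_trans (oadd_lt_r _ w_lt); apply: IH => //.
exact: ole_trans (oltW w_lt) yn.
Qed.

(** Ordinals below omega^a are bounded by finite multiples of some omega^d with
    d < a, and two of these can be bounded with the same d; such multiples add
    up by the previous lemma at d. *)
Lemma opow_closedP a : opow_closed a.
Proof.
elim/(well_founded_ind olt_wf): a => a IH x y xa ya.
have [x0|[d da [m xm]]] := olt_opow xa.
  apply: ole_lt_trans ya; rewrite -[y in X in _ <=o X]add0h.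
  exact: hadd_mono.
have [y0|[e ea [n yn]]] := olt_opow ya.
  apply: ole_lt_trans xa; rewrite -[x in X in _ <=o X]hadd0.
  exact: hadd_mono.
have [c ca [xc yc]] : exists2 c, c <o a &
    x <=o omul (opow c) (onat m) /\ y <=o omul (opow c) (onat n).
  have [de|ed] := ole_total d e; [exists e|exists d] => //; split=> //.
    by apply: ole_trans xm _; apply: omul_mono; exact: opow_mono.
  apply: ole_trans yn _; apply: omul_mono; apply: opow_mono; exact: oltW.
apply: ole_lt_trans (hadd_mono xc yc) _.
apply: (@ole_lt_trans (omul (opow c) (onat (m + n)))); last first.
  apply: olt_le_trans (omul_nat_lt_omega _ (opow_gt0 c)) _; exact: opow_lt.
elim: m {xm xc} => [|m IHm]; first by rewrite omul_nat0 add0h.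
rewrite addSn !omul_natSl.
apply: ole_trans (hadd_mono (oadd_le_hadd _ _) (ole_refl _)) _.
rewrite -haddA; apply: ole_trans (hadd_mono (ole_refl _) IHm) _.
by apply: hadd_opow_of_closed (IH c ca) _.
Qed.

Lemma hadd_opow a n y :
  y <=o omul (opow a) (onat n) -> opow a +h y =o oadd (opow a) y.
Proof.
move=> yn; split; last exact: oadd_le_hadd.
by apply: hadd_opow_of_closed yn; exact: opow_closedP.
Qed.

Definition hsum (F : ord -> ord) (s : seq ord) : ord :=
  foldr (fun x v => F x +h v) ozero s.

Lemma hsum_cat F s t : hsum F (s ++ t) =o hsum F s +h hsum F t.
Proof. by elim: s => [|x s IH] /=; [rewrite add0h|rewrite IH haddA]. Qed.

Lemma hsum_eq F G s : (forall x, F x =o G x) -> hsum F s =o hsum G s.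
Proof. by move=> FG; elim: s => //= x s IH; rewrite FG IH. Qed.

Lemma hsum_insert F a s : hsum F (oinsert a s) =o F a +h hsum F s.
Proof.
elim: s => //= b s IH; case: asboolP => //= _.
by rewrite IH haddCA.
Qed.

Lemma hsum_sort F s : hsum F (osort s) =o hsum F s.
Proof. by elim: s => //= a s IH; rewrite hsum_insert IH. Qed.

Lemma hsum_split F G s : hsum (fun x => F x +h G x) s =o hsum F s +h hsum G s.
Proof. by elim: s => [|x s IH] /=; [rewrite hadd0|rewrite IH haddACA]. Qed.

Lemma hsum0 s : hsum (fun=> ozero) s =o ozero.
Proof. by elim: s => //= x s IH; rewrite IH hadd0. Qed.

Lemma hsum_swap (F : ord -> ord -> ord) s t :
  hsum (fun x => hsum (F x) t) s =o hsum (fun y => hsum (F^~ y) s) t.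
Proof.
elim: s => [|x s IH] /=; first by rewrite hsum0.
by rewrite hsum_split IH.
Qed.

Lemma nonincreasing_tail a s : nonincreasing (a :: s) -> nonincreasing s.
Proof. by case: s => // b s []. Qed.

Lemma nonincreasing_sort s : nonincreasing (osort s).
Proof.
elim: s => //= a s; elim: (osort s) => //= b u IH ni.
case: asboolP => [//|/ole_notlt/ole_notlt ab].
have {}ab : a <=o b by case: (ole_total b a) => // /oltW.
have := IH (nonincreasing_tail ni).
by case: u ni {IH} => //= c u [cb _]; case: asboolP.
Qed.

Lemma cnf_val_bound a s : nonincreasing (a :: s) ->
  cnf_val s <=o omul (opow a) (onat (size s)).
Proof.
elim: s a => // b s IH a /= [ba ni]; rewrite -/(onat _) omul_natSl.
apply: oadd_mono; first exact: opow_mono.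
by apply: ole_trans (IH _ ni) _; apply: omul_mono; exact: opow_mono.
Qed.

Lemma cnf_val_hsum s : nonincreasing s -> cnf_val s =o hsum opow s.
Proof.
elim: s => //= a s IH ni; rewrite -(hadd_opow (cnf_val_bound ni)).
by rewrite -IH //; exact: nonincreasing_tail ni.
Qed.

Lemma cnf_val_sort s : cnf_val (osort s) =o hsum opow s.
Proof. by rewrite cnf_val_hsum ?hsum_sort //; exact: nonincreasing_sort. Qed.

Lemma cnfP a : hsum opow (cnf a) =o a.
Proof.
rewrite /cnf; case: cid => s [ni sa] /=.
by apply: oeq_trans sa; apply: oeq_sym; exact: cnf_val_hsum.
Qed.

Lemma nadd_hadd a b : nadd a b =o a +h b.
Proof. by rewrite /nadd cnf_val_sort hsum_cat !cnfP. Qed.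

(** The Hessenberg product in terms of lists of exponents. The lists need not be
    sorted: by [hsum_sort] only their entries matter. This makes it possible to
    reason on products without normalizing. *)
Definition hmul (s t : seq ord) : ord :=
  hsum (fun x => hsum (fun y => opow (x +h y)) t) s.

Lemma nmul_hmul a b : nmul a b =o hmul (cnf a) (cnf b).
Proof.
rewrite /nmul cnf_val_sort /hmul; elim: (cnf a) => //= x s IH.
rewrite hsum_cat IH; suff -> : forall t, hsum opow [seq nadd x y | y <- t] =o
    hsum (fun y => opow (x +h y)) t by [].
by elim=> //= y t ->; rewrite nadd_hadd.
Qed.

Lemma hsum_lt_opow F s c : List.Forall (fun x => F x <o opow c) s ->
  hsum F s <o opow c.
Proof.
elim: s => // x s IH /List.Forall_cons_iff[xc sc] /=.
by apply: opow_closedP => //; exact: IH.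
Qed.

Lemma Forall_hsum s : List.Forall (fun x => opow x <=o hsum opow s) s.
Proof.
elim: s => // x s IH; apply/List.Forall_cons_iff; split; first exact: hadd_ge_l.
apply: List.Forall_impl IH => y h; apply: ole_trans h _; exact: hadd_ge_r.
Qed.

Lemma hsum_lt_opow_inv s c : hsum opow s <o opow c ->
  List.Forall (fun x => x <o c) s.
Proof.
move=> sc; apply: List.Forall_impl (Forall_hsum s) => x xs.
by apply: opow_lt_inv; exact: ole_lt_trans xs sc.
Qed.

Lemma hmulC s t : hmul s t =o hmul t s.
Proof.
rewrite /hmul hsum_swap; apply: hsum_eq => y; apply: hsum_eq => x.
by rewrite haddC.
Qed.

(** All that is used of s being a permutation of x :: s'. *)
Definition splits (s : seq ord) (x : ord) (s' : seq ord) : Prop :=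
  forall F, hsum F s =o F x +h hsum F s'.

Lemma olt_hsum F s c : c <o hsum F s ->
  exists x s', splits s x s' /\ exists2 d, d <o F x & c <=o d +h hsum F s'.
Proof.
elim: s c => [c /oltn0//|x s IH c /= /olt_haddP[[d dx cd]|[d /IH]]].
  by exists x, s; split; [|exists d].
move=> [y [s' [ss' [e ey de]]]] cd; exists y, (x :: s'); split.
  by move=> G /=; rewrite ss' haddCA.
exists e => //=; rewrite haddCA; apply: ole_trans cd _; exact: hadd_mono.
Qed.

Lemma hmul_splits_l s x s' t : splits s x s' -> hmul s t =o hmul (x :: s') t.
Proof. by move=> ss'; exact: ss'. Qed.

Lemma hmul_splits_r s t y t' : splits t y t' -> hmul s t =o hmul s (y :: t').
Proof. by move=> tt'; apply: hsum_eq => x; exact: tt'. Qed.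

(** One half of the subtraction of a rectangle: only the exponent x of the
    left factor is replaced, by the exponents l of a smaller ordinal; the term
    for (x, y) of the product then becomes the sum bounding d. *)
Lemma hmul_lt_left x s y t l c d r : hsum opow l <o opow x ->
    d <=o hsum (fun u => opow (u +h y)) l ->
    opow (x +h y) +h r =o hmul (x :: s) (y :: t) -> c <=o d +h r ->
  c +h hmul (l ++ s) t <=o hmul (l ++ s) (y :: t) +h hmul (x :: s) t.
Proof.
move=> lx dl hr cdr.
pose Y u := opow (u +h y); pose R u := hsum (fun v => opow (u +h v)) t.
have {}hr : r =o R x +h hsum (fun u => Y u +h R u) s.
  move: hr; rewrite /hmul /= -haddA => -[h1 h2]; rewrite haddC in h1.
  rewrite [X in _ <=o X]haddC in h1; rewrite haddC [X in _ <=o X]haddC in h2.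
  by split; apply: hadd_cancel; [exact: h1|exact: h2].
have -> : hmul (l ++ s) t =o hsum R l +h hsum R s by exact: hsum_cat.
have -> : hmul (l ++ s) (y :: t) =o
    (hsum Y l +h hsum R l) +h (hsum Y s +h hsum R s).
  rewrite -[X in _ =o X +h _]hsum_split -[X in _ =o _ +h X]hsum_split.
  exact: (hsum_cat (fun u => Y u +h R u)).
have -> : hmul (x :: s) t =o R x +h hsum R s by [].
apply: ole_trans (hadd_mono cdr (ole_refl _)) _.
rewrite hr hsum_split.
apply: ole_trans (hadd_mono (hadd_mono dl (ole_refl _)) (ole_refl _)) _.
rewrite -/(hsum Y l).
by rewrite haddACA (haddC (R x) (_ +h _)) -!haddA.
Qed.

(** Conway's recursive description of the natural product: the ordinals below
    a b are those bounded by some a' b + a b' - a' b' with a' < a, b' < b.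
    Here c is obtained from the product by lowering one term omega^(x +h y) to
    a multiple of omega^f with f < x +h y, so that f <= x' +h y or
    f <= x +h y' for a smaller x' or y'. Then b' is b without the term
    omega^y, and a' is a with omega^x replaced by a multiple of omega^x' (or
    symmetrically). *)
Lemma olt_hmul s t c : c <o hmul s t -> exists s0 t0,
  [/\ hsum opow s0 <o hsum opow s, hsum opow t0 <o hsum opow t &
      c +h hmul s0 t0 <=o hmul s0 t +h hmul s t0].
Proof.
move=> /olt_hsum[x [s' [ss' [e /olt_hsum[y [t' [tt' [d dxy ed]]]] ce]]]].
pose r := hsum (fun v => opow (x +h v)) t' +h
          hsum (fun u => hsum (fun v => opow (u +h v)) t) s'.
have hr : opow (x +h y) +h r =o hmul (x :: s') (y :: t').
  rewrite -(hmul_splits_r _ tt') /hmul /= haddA; apply: hadd_proper => //.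
  by rewrite (tt' (fun v => opow (x +h v))).
have cdr : c <=o d +h r.
  by apply: ole_trans ce _; rewrite haddA; exact: hadd_mono.
have left_case l : hsum opow l <o opow x ->
    d <=o hsum (fun u => opow (u +h y)) l -> exists s0 t0,
    [/\ hsum opow s0 <o hsum opow s, hsum opow t0 <o hsum opow t &
        c +h hmul s0 t0 <=o hmul s0 t +h hmul s t0].
  move=> lx dl; exists (l ++ s'), t'; split.
  - by rewrite (ss' opow) hsum_cat; exact: hadd_lt_l.
  - rewrite (tt' opow) -[X in X <o _]add0h; exact: hadd_lt_l.
  rewrite (hmul_splits_r _ tt') (hmul_splits_l _ ss').
  exact: hmul_lt_left lx dl hr cdr.
have [d0|[f fxy [n dn]]] := olt_opow dxy.
  by apply: (left_case [::]).
have bound g h : f <=o g +h h ->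
    hsum (fun u => opow (u +h h)) (nseq n g) =o
    hsum (fun=> opow (g +h h)) (nseq n g) /\
    d <=o hsum (fun=> opow (g +h h)) (nseq n g).
  move=> fgh; split; first by elim: (n) => //= m ->.
  apply: ole_trans dn _; elim: (n) => [|m IH]; first by rewrite omul_nat0.
  rewrite omul_natSl /=; apply: ole_trans (oadd_le_hadd _ _) _.
  by apply: hadd_mono => //; exact: opow_mono.
have small g h : g <o h -> hsum opow (nseq n g) <o opow h.
  move=> gh; apply: hsum_lt_opow; elim: (n) => // m IH /=.
  by apply/List.Forall_cons_iff; split=> //; exact: opow_strict.
have [[x' x'x fx]|[y' y'y fy]] := proj1 (olt_haddP _ _ _) fxy.
  have [e1 e2] := bound _ _ fx.
  by apply: (left_case (nseq n x')); [exact: small|rewrite e1].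
rewrite haddC in fy; have [e1 e2] := bound _ _ fy.
exists s', (nseq n y' ++ t'); split.
- rewrite (ss' opow) -[X in X <o _]add0h; exact: hadd_lt_l.
- rewrite (tt' opow) hsum_cat; apply: hadd_lt_l; exact: small.
rewrite (hmul_splits_l _ ss') (hmul_splits_r _ tt').
rewrite (hmulC s') (hmulC s') (hmulC (x :: s')) [X in _ <=o X]haddC.
apply: (hmul_lt_left (small _ _ y'y) _ _ cdr); first by rewrite e1.
by rewrite (haddC y x) hr hmulC.
Qed.

(** * Exponents of finite and infinite ordinals *)

Lemma hadd1 a : oone +h a =o osucc a.
Proof.
split; last first.
  apply/oleP => -[] /=.
  by rewrite -[X in X <o _]add0h; apply: hadd_lt_l; exact/olt1.
elim/(well_founded_ind olt_wf): a => a IH; apply/hadd_leP; split=> x.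
  move=> /olt1 x0; apply/olt_succ; rewrite -[a in X in _ <=o X]add0h.
  exact: hadd_mono.
move=> xa; apply/olt_succ; apply: ole_trans (IH _ xa) _.
by apply/oleP => -[].
Qed.

Lemma ofinite_cnf a : ofinite a -> List.Forall (fun x => x <=o ozero) (cnf a).
Proof.
move=> [n an]; have lt1 : oone <o opow oone.
  by rewrite -[X in X <o _]opow0; apply: opow_strict; exact/olt1.
have : hsum opow (cnf a) <o opow oone.
  rewrite cnfP an; elim: n {an} => [//|n IH] /=.
  by rewrite -[osucc _]/(osucc (onat n)) -hadd1; exact: opow_closedP.
by move=> /hsum_lt_opow_inv; apply: List.Forall_impl => x /olt1.
Qed.

Lemma cnf_ofinite a : List.Forall (fun x => x <=o ozero) (cnf a) -> ofinite a.
Proof.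
move=> fa; exists (size (cnf a)); rewrite -[X in X =o _]cnfP.
elim: (cnf a) fa => //= x s IH /List.Forall_cons_iff[x0 /IH ->].
have -> : x =o ozero by [].
by rewrite opow0 hadd1.
Qed.

Lemma infinite_cnf a : ~ ofinite a ->
  exists2 y, List.In y (cnf a) & ozero <o y.
Proof.
move=> na; apply: contrapT => h; apply: na; apply: cnf_ofinite.
apply/List.Forall_forall => x xa; apply/ole_notlt => x0.
by apply: h; exists x.
Qed.

Lemma hsum_In F s x : List.In x s -> F x <=o hsum F s.
Proof.
elim: s => //= y s IH [->|/IH]; first exact: hadd_ge_l.
by move=> h; apply: ole_trans h _; exact: hadd_ge_r.
Qed.

Lemma hmul_In s t x y : List.In x s -> List.In y t ->
  opow (x +h y) <=o hmul s t.
Proof.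
move=> xs yt; apply: ole_trans (hsum_In (fun y => opow (x +h y)) yt) _.
exact: (hsum_In (fun x => hsum (fun y => opow (x +h y)) t)).
Qed.

Lemma leading_exponent a : ozero <o a -> exists e,
  [/\ List.In e (cnf a), opow e <=o a & a <o opow (osucc e)].
Proof.
move=> a0; have sa := cnfP a; move: sa; rewrite /cnf.
case: cid => s [ni _] /=; case: s ni => [_ /= a00|e s ni sa].
  by case: (@oltn0 ozero); rewrite {2}a00.
exists e; split; first by left.
  by rewrite -sa; exact: hadd_ge_l.
have vsa : cnf_val (e :: s) =o a by rewrite cnf_val_hsum.
rewrite -vsa opowS.
have nie : nonincreasing (e :: e :: s) by [].
exact: ole_lt_trans (cnf_val_bound nie) (omul_nat_lt_omega _ (opow_gt0 e)).
Qed.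

(** The exponents of a finite ordinal are all 0, so the exponents of the product
    are among those of the left factor. *)
Lemma nmul_finite_lt a b c : a <o opow c -> ofinite b -> nmul a b <o opow c.
Proof.
move=> ac /ofinite_cnf fb; rewrite nmul_hmul /hmul; apply: hsum_lt_opow.
rewrite -(cnfP a) in ac; apply: List.Forall_impl (hsum_lt_opow_inv ac) => x xc.
apply: hsum_lt_opow; apply: List.Forall_impl fb => y y0.
apply: opow_strict; apply: ole_lt_trans xc; rewrite -[X in _ <=o X]hadd0.
exact: hadd_mono.
Qed.

(** An infinite ordinal has a nonzero exponent y, and e < f +h y for every
    f >= e. *)
Lemma nmul_infinite_ge a b e :
  opow e <=o a -> ~ ofinite b -> opow (osucc e) <=o nmul a b.
Proof.
move=> ea /infinite_cnf[y yb y0].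
have [f [fa _ af]] := leading_exponent (olt_le_trans (opow_gt0 e) ea).
have ef : e <=o f.
  by apply/olt_succ; apply: opow_lt_inv; exact: ole_lt_trans ea af.
rewrite nmul_hmul; apply: ole_trans (hmul_In fa yb); apply: opow_mono.
apply/oleP => -[] /=; apply: ole_lt_trans ef _.
by rewrite -[X in X <o _]hadd0; exact: hadd_lt_r.
Qed.

(** * Ranks of subsets of a topological space *)

(** Taking traces of closed sets on arbitrary subsets S avoids subspace
    topologies: rank S is the rank of the subspace S, and pieces such as
    S `\` C have a rank of their own. *)
Definition rsub (T : topologicalType) (R S : set T) : Prop :=
  R <> S /\ exists2 C, closed C & R = S `&` C.

Definition dcc (T : topologicalType) : Prop := well_founded (@rsub T).

Definition rank (T : topologicalType) (S : set T) : ord := rk (@rsub T) S.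

Lemma rsubIP (T : topologicalType) (S C : set T) :
  closed C -> ~ S `<=` C -> rsub (S `&` C) S.
Proof.
by move=> cC nSC; split; [move=> /setIidPl|exists C].
Qed.

Lemma rsubP (T : topologicalType) (R S : set T) : rsub R S <->
  exists2 C, closed C & R = S `&` C /\ ~ S `<=` C.
Proof.
split=> [[RS [C cC RE]]|[C cC [-> nSC]]]; last exact: rsubIP.
by exists C => //; split=> // SC; apply: RS; rewrite RE; exact/setIidPl.
Qed.

Lemma rsub_trans (T : topologicalType) (Q R S : set T) :
  rsub Q R -> rsub R S -> rsub Q S.
Proof.
move=> /rsubP[D cD [QE nRD]] /rsubP[C cC [RE nSC]].
rewrite QE RE -setIA; apply: rsubIP; first exact: closedI.
by move=> SCD; apply: nSC => x /SCD[].
Qed.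

Lemma olt_rank (T : topologicalType) (S : set T) c : dcc T ->
  c <o rank S <-> exists2 R, rsub R S & c <=o rank R.
Proof.
move=> wf; rewrite /rank (rkE _ wf); split=> [[[R RS] /= cR]|[R RS cR]].
  by exists R.
by exists (exist _ R RS).
Qed.

Lemma rank_rsub (T : topologicalType) (R S : set T) : dcc T ->
  rsub R S -> rank R <o rank S.
Proof. by move=> wf RS; apply/(olt_rank _ _ wf); exists R. Qed.

Lemma rank_leP (T : topologicalType) (S : set T) c : dcc T ->
  (forall R, rsub R S -> rank R <o c) -> rank S <=o c.
Proof.
move=> wf h; apply: ole_ltP => d /(olt_rank _ _ wf)[R RS dR].
exact: ole_lt_trans dR (h _ RS).
Qed.

Lemma rank_set0 (T : topologicalType) : dcc T -> rank (@set0 T) =o ozero.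
Proof.
move=> wf; split=> //; apply: (rank_leP wf) => R /rsubP[C _ [_]]; case.
exact: sub0set.
Qed.

Lemma rank_gt0 (T : topologicalType) (S : set T) : dcc T ->
  S !=set0 -> ozero <o rank S.
Proof.
move=> wf [x Sx]; apply: (ole_lt_trans (ole0 (rank (@set0 T)))).
apply: rank_rsub => //; rewrite -(setI0 S); apply: rsubIP; first exact: closed0.
by move=> /(_ x Sx).
Qed.

Lemma rank_mono (T : topologicalType) (R S : set T) : dcc T ->
  R `<=` S -> rank R <=o rank S.
Proof.
move=> wf; elim/(well_founded_ind wf): S R => S IH R RS.
apply: (rank_leP wf) => _ /rsubP[C cC [-> nRC]].
have lt : rsub (S `&` C) S.
  by apply: rsubIP => // SC; apply: nRC; exact: subset_trans SC.
apply: ole_lt_trans (rank_rsub wf lt); apply: IH => //; exact: setSI.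
Qed.

(** A closed part of least rank among those of rank at least c has rank c. *)
Lemma rank_hit (T : topologicalType) (S : set T) c : dcc T ->
  c <o rank S -> exists2 R, rsub R S & rank R =o c.
Proof.
move=> wf; elim/(well_founded_ind wf): S => S IH /(olt_rank _ _ wf)[R RS cR].
have [Rc|cltR] := ole_total (rank R) c; first by exists R.
by have [Q QR Qc] := IH _ RS cltR; exists Q => //; exact: rsub_trans RS.
Qed.

Lemma rsubU_cases (T : topologicalType) (Q R S : set T) : rsub Q (R `|` S) ->
  exists R' S', Q = R' `|` S' /\
    (rsub R' R /\ S' `<=` S \/ R' = R /\ rsub S' S).
Proof.
move=> /rsubP[C cC [-> nC]]; exists (R `&` C), (S `&` C).
split; first by rewrite setIUl.
have [RC|nRC] := pselect (R `<=` C); last by left; split => //; exact: rsubIP.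
right; split; first exact/setIidPl.
by apply: rsubIP => // SC; apply: nC => x [/RC|/SC].
Qed.

(** A trace on a union is determined by its traces on the two sets, and
    shrinks only if one of these does. *)
Lemma rank_setU (T : topologicalType) (R S : set T) : dcc T ->
  rank (R `|` S) <=o rank R +h rank S.
Proof.
move=> wf; elim/(well_founded_ind wf): R S => R IHR S.
elim/(well_founded_ind wf): S => S IHS.
apply: (rank_leP wf) => _ /rsubU_cases[R' [S' [-> [[RR SS]|[-> SS]]]]].
  apply: ole_lt_trans (IHR _ RR S') _.
  apply: (@ole_lt_trans (rank R' +h rank S)).
    by apply: hadd_mono => //; exact: rank_mono.
  by apply: hadd_lt_l; exact: rank_rsub.
by apply: ole_lt_trans (IHS _ SS) _; apply: hadd_lt_r; exact: rank_rsub.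
Qed.

(** The traces containing S `&` C, which are the unions of S `&` C with
    traces on S `\` C, come after the traces on S `&` C. *)
Lemma rank_closed_add (T : topologicalType) (S C : set T) : dcc T -> closed C ->
  oadd (rank (S `&` C)) (rank (S `\` C)) <=o rank S.
Proof.
move=> wf cC; elim/(well_founded_ind wf): S => S IH.
apply: ole_ltP => c /olt_addP[h|[b]].
  by apply: olt_le_trans h _; apply: rank_mono => //; exact: subIsetl.
move=> /(olt_rank _ _ wf)[_ /rsubP[D cD [-> nD]] bR] cb.
have lt : rsub (S `&` (C `|` D)) S.
  apply: rsubIP; first exact: closedU.
  by move=> SCD; apply: nD => x [/SCD[]].
apply: ole_lt_trans (rank_rsub wf lt).
apply: ole_trans (IH _ lt); apply: ole_trans cb _; apply: oadd_mono.
  by apply: rank_mono => // x [Sx Cx]; do !split=> //; left.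
apply: ole_trans bR _; apply: rank_mono => // x [[Sx nCx] Dx].
by do !split=> //; right.
Qed.

(** By distributivity, shrinking C within S shrinks C `|` D or C `&` D: if
    neither changed, C would not change. So each step down on the left is
    matched by a step down on the right. *)
Lemma rank_supermodular (T : topologicalType) (S C D : set T) : dcc T ->
    closed C -> closed D ->
  rank (S `&` C) +h rank (S `&` D) <=o
  rank (S `&` (C `|` D)) +h rank (S `&` (C `&` D)).
Proof.
move=> wf.
have step A B E : closed A -> closed B -> closed E ->
    rsub (S `&` A `&` E) (S `&` A) ->
    rank (S `&` ((A `&` E) `|` B)) +h rank (S `&` ((A `&` E) `&` B)) <o
    rank (S `&` (A `|` B)) +h rank (S `&` (A `&` B)).
  move=> cA cB cE [neq _].
  have cAE : closed (A `&` E) by exact: closedI.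
  have EU : S `&` (A `&` E `|` B) = S `&` (A `|` B) `&` (A `&` E `|` B).
    by rewrite -[RHS]setIA (setIidr (A := A `|` B)) // => x [[]|]; [left|right].
  have EI : S `&` (A `&` E `&` B) = S `&` (A `&` B) `&` (A `&` E `&` B).
    by rewrite -[RHS]setIA (setIidr (A := A `&` B)) // => x [[]].
  have [subU|nU] := pselect (S `&` (A `|` B) `<=` A `&` E `|` B); last first.
    have lt : rsub (S `&` (A `&` E `|` B)) (S `&` (A `|` B)).
      by rewrite EU; apply: rsubIP => //; exact: closedU.
    apply: ole_lt_trans (hadd_lt_l _ (rank_rsub wf lt)).
    by apply: hadd_mono => //; apply: rank_mono => // x [Sx [[]]].
  have lt : rsub (S `&` (A `&` E `&` B)) (S `&` (A `&` B)).
    rewrite EI; apply: rsubIP; first exact: closedI.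
    move=> subI; apply: neq; apply/setIidPl => x [Sx Ax].
    have [Bx|nBx] := pselect (B x).
      by have [] := subI x (conj Sx (conj Ax Bx)); case.
    by have [|//] := subU x (conj Sx (or_introl Ax)); case.
  apply: ole_lt_trans (hadd_lt_r _ (rank_rsub wf lt)).
  apply: hadd_mono => //; apply: rank_mono => // x [Sx ABx]; split=> //.
  by case: ABx; [case; left|right].
move RE : (S `&` C) => R; elim/(well_founded_ind wf): R C D RE => R IHR C D RE.
move QE : (S `&` D) => Q.
elim/(well_founded_ind wf): Q D QE => Q IHQ D QE cC cD.
apply/hadd_leP; split=> c /(olt_rank _ _ wf)[_ /rsubP[E cE [-> nE]]] cR.
  apply: ole_lt_trans (hadd_mono cR (ole_refl _)) _.
  have lt : rsub (S `&` C `&` E) (S `&` C) by apply: rsubIP => //; rewrite RE.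
  apply: (ole_lt_trans _ (step C D E cC cD cE lt)).
  rewrite -QE -RE in IHR *; apply: (IHR _ lt) => //.
    by rewrite setIA.
  exact: closedI.
apply: ole_lt_trans (hadd_mono (ole_refl _) cR) _.
have lt : rsub (S `&` D `&` E) (S `&` D) by apply: rsubIP => //; rewrite QE.
have {}lts := step D C E cD cC cE lt; rewrite (setUC D C) (setIC D C) in lts.
apply: (ole_lt_trans _ lts).
rewrite (setUC _ C) (setIC _ C) -QE in IHQ *; apply: (IHQ _ lt) => //.
  by rewrite setIA.
exact: closedI.
Qed.

(** Cut along a closed part of rank exactly omega^a; ordinal addition can be
    cancelled on the left. *)
Lemma rank_cut (T : topologicalType) (S : set T) a c : dcc T ->
    rank S <=o oadd (opow a) c ->
  exists C, rank (S `&` C) <=o opow a /\ rank (S `\` C) <=o c.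
Proof.
move=> wf Sac; have [Sa|aS] := ole_total (rank S) (opow a).
  by exists setT; rewrite setIT setDT (rank_set0 wf).
have [_ [_ [C cC ->]] SC] := rank_hit wf aS.
exists C; split; first by rewrite SC.
apply: (@oadd_cancel (opow a)); apply: ole_trans Sac; rewrite -{1}SC.
exact: rank_closed_add.
Qed.

(** A set of rank omega^x_1 + ... + omega^x_m, with exponents in decreasing
    order, is cut into pieces of ranks at most omega^x_i, to which Phi is
    applied separately. For a product, Phi maps one side of a box to the box. *)
Lemma rank_pieces (T U : topologicalType) (Phi : set T -> set U) F s A :
    dcc T -> dcc U -> Phi set0 = set0 ->
    (forall A B, Phi (A `|` B) = Phi A `|` Phi B) ->
    List.Forall
      (fun x => forall A, rank A <=o opow x -> rank (Phi A) <=o F x) s ->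
  rank A <=o hsum opow s -> rank (Phi A) <=o hsum F s.
Proof.
move=> wT wU Phi0 PhiU hF hA.
have {}hF : List.Forall
    (fun x => forall A, rank A <=o opow x -> rank (Phi A) <=o F x) (osort s).
  elim: s hF {hA} => //= x s IH /List.Forall_cons_iff[hx /IH].
  elim: (osort s) => [_|y u IHu /List.Forall_cons_iff[hy hu]] /=.
    by apply/List.Forall_cons_iff.
  case: asboolP => _; apply/List.Forall_cons_iff; split=> //.
    by apply/List.Forall_cons_iff.
  exact: IHu.
rewrite -(hsum_sort F) -cnf_val_sort in hA *.
elim: (osort s) hF A hA => [_ A A0|x u IH /List.Forall_cons_iff[hx hu] A /=].
  suff -> : A = set0 by rewrite Phi0 (rank_set0 wU).
  apply/eqP/negPn/negP => /set0P/(rank_gt0 wT); apply/ole_notlt; exact: A0.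
move=> /(rank_cut wT)[C [h1 h2]].
rewrite -(setUIDK A C) PhiU; apply: ole_trans (rank_setU _ _ wU) _.
by apply: hadd_mono; [exact: hx|exact: IH].
Qed.

(** * Products *)

Lemma Acc_rsub_subset (T : topologicalType) (R S : set T) :
  Acc (@rsub T) S -> R `<=` S -> Acc (@rsub T) R.
Proof.
move=> accS; elim: accS R => {}S _ IH R RS.
constructor => _ /rsubP[C cC [-> nRC]].
apply: (IH (S `&` C)); last exact: setSI.
by apply: rsubIP => // SC; apply: nRC; exact: subset_trans SC.
Qed.

Lemma Acc_rsub_setU (T : topologicalType) (R S : set T) :
  Acc (@rsub T) R -> Acc (@rsub T) S -> Acc (@rsub T) (R `|` S).
Proof.
move=> accR; elim: accR S => {}R accR IHR S accS; elim: accS => {}S accS IHS.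
constructor => _ /rsubU_cases[R' [S' [-> [[RR SS]|[-> SS]]]]].
  apply: (IHR _ RR); apply: Acc_rsub_subset SS; exact: Acc_intro.
exact: IHS.
Qed.

Lemma dcc_setT (T : topologicalType) : Acc (@rsub T) setT -> dcc T.
Proof. by move=> accT S; exact: Acc_rsub_subset accT _. Qed.

(** Words of length n + 1 are a product in two ways, by the first and by the
    last letter; this covers both. *)
Record is_product (T T1 T2 : topologicalType) (p : T -> T1) (q : T -> T2) :
    Prop := IsProduct {
  product_fst : continuous p;
  product_snd : continuous q;
  product_pair : forall x y, exists w, p w = x /\ q w = y;
  product_box : forall U w, open U -> U w -> exists V W,
    [/\ open V, open W, V (p w), W (q w) &
        forall v, V (p v) -> W (q v) -> U v] }.

Section products.
Context {T T1 T2 : topologicalType} {p : T -> T1} {q : T -> T2}.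
Hypothesis pq : is_product p q.

Let box (A : set T1) (B : set T2) : set T := p @^-1` A `&` q @^-1` B.

Let closed_fst C : closed C -> closed (p @^-1` C).
Proof.
by move=> cC; apply: preimage_closed cC => x _; exact: product_fst pq _.
Qed.

Let closed_snd C : closed C -> closed (q @^-1` C).
Proof.
by move=> cC; apply: preimage_closed cC => x _; exact: product_snd pq _.
Qed.

(** A point of the box outside S has a rectangular neighborhood that misses the
    closed set of which S is the trace. *)
Lemma rsub_box A B S : rsub S (box A B) -> exists A' B',
  [/\ rsub A' A, rsub B' B & S `<=` box A' B `|` box A B'].
Proof.
move=> /rsubP[C cC [-> nC]].
have [w [[Aw Bw] nCw]] : exists w, box A B w /\ ~ C w.
  apply: contrapT => h; apply: nC => w ABw; apply: contrapT => nCw.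
  by apply: h; exists w.
have [V [W [oV oW Vw Ww VW]]] := product_box pq (closed_openC cC) nCw.
exists (A `&` ~` V), (B `&` ~` W); split.
- by apply: rsubIP; [exact: open_closedC|move=> /(_ _ Aw)].
- by apply: rsubIP; [exact: open_closedC|move=> /(_ _ Bw)].
move=> v [[Av Bv] Cv]; have [Vv|nVv] := pselect (V (p v)); last by left.
by right; split=> //; split=> // Wv; exact: VW Vv Wv Cv.
Qed.

Lemma dcc_product : dcc T1 -> dcc T2 -> dcc T.
Proof.
move=> w1 w2; apply: dcc_setT; suff h A B : Acc (@rsub T) (box A B).
  by apply: Acc_rsub_subset (h setT setT) _.
elim: {A}(w1 A) B => A _ IHA B; elim: {B}(w2 B) => B _ IHB.
constructor=> S /rsub_box[A' [B' [AA BB]]]; apply: Acc_rsub_subset.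
by apply: Acc_rsub_setU; [exact: IHA|exact: IHB].
Qed.

Hypotheses (w1 : dcc T1) (w2 : dcc T2).
Let wT : dcc T := dcc_product w1 w2.

Let box0l B : box set0 B = set0.
Proof. by rewrite /box preimage_set0 set0I. Qed.
Let box0r A : box A set0 = set0.
Proof. by rewrite /box preimage_set0 setI0. Qed.
Let boxUl A A' B : box (A `|` A') B = box A B `|` box A' B.
Proof. by rewrite /box preimage_setU setIUl. Qed.
Let boxUr A B B' : box A (B `|` B') = box A B `|` box A B'.
Proof. by rewrite /box preimage_setU setIUr. Qed.

(** The two strips covering a proper closed part of the box decompose into boxes
    with sides of ranks omega^a', omega^b for some a' < a, or omega^a, omega^b'
    for some b' < b; and omega^(a +h b) is not a Hessenberg sum of finitely
    many smaller ordinals. *)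
Lemma rank_box_opow a b A B : rank A <=o opow a -> rank B <=o opow b ->
  rank (box A B) <=o opow (a +h b).
Proof.
elim/(well_founded_ind olt_wf): a b A B => a IHa.
elim/(well_founded_ind olt_wf) => b IHb A B Aa Bb.
apply: (rank_leP wT) => S /rsub_box[A' [B' [AA BB]]] /(rank_mono wT) sub.
apply: ole_lt_trans sub _; apply: ole_lt_trans (rank_setU _ _ wT) _.
have {AA} : rank A' <o opow a by exact: olt_le_trans (rank_rsub w1 AA) Aa.
have {BB} : rank B' <o opow b by exact: olt_le_trans (rank_rsub w2 BB) Bb.
rewrite -(cnfP (rank A')) -(cnfP (rank B')) => B'b A'a.
apply: opow_closedP.
  have A's := proj2 (cnfP (rank A')).
  have sa := hsum_lt_opow_inv A'a.
  apply: ole_lt_trans (rank_pieces (Phi := box^~ B)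
    (F := fun x => opow (x +h b)) w1 wT _ _ _ A's) _ => //.
    by apply: List.Forall_impl sa => x xa A0 A0x; exact: IHa.
  apply: hsum_lt_opow; apply: List.Forall_impl sa => x xa.
  by apply: opow_strict; exact: hadd_lt_l.
have B's := proj2 (cnfP (rank B')).
have sb := hsum_lt_opow_inv B'b.
apply: ole_lt_trans (rank_pieces (Phi := box A)
  (F := fun y => opow (a +h y)) w2 wT _ _ _ B's) _ => //.
  by apply: List.Forall_impl sb => y yb B0 B0y; exact: IHb.
apply: hsum_lt_opow; apply: List.Forall_impl sb => y yb.
by apply: opow_strict; exact: hadd_lt_r.
Qed.

Lemma rank_box_le A B s t : rank A <=o hsum opow s -> rank B <=o hsum opow t ->
  rank (box A B) <=o hmul s t.
Proof.
move=> As Bt.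
apply: (rank_pieces (Phi := box^~ B) w1 wT _ _ _ As) => //.
apply/List.Forall_forall => x _ A0 A0x.
apply: (rank_pieces (Phi := box A0) w2 wT _ _ _ Bt) => //.
by apply/List.Forall_forall => y _ B0 B0y; exact: rank_box_opow.
Qed.

(** By induction on the box. For c below the product there are a' < a, b' < b
    such that c + a' b' <= a' b + a b'. If A', B' are closed parts of ranks a',
    b', the strips A' x B and A x B' have ranks at least a' b and a b' by
    induction, and they meet in A' x B', of rank at most a' b'. By
    supermodularity, their union, a proper closed part of A x B, has rank at
    least c. *)
Lemma rank_box_ge A B s t : hsum opow s <=o rank A -> hsum opow t <=o rank B ->
  hmul s t <=o rank (box A B).
Proof.
elim/(well_founded_ind w1): A B s t => A IHA.
elim/(well_founded_ind w2) => B IHB s t sA tB.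
apply: ole_ltP => c /olt_hmul[s0 [t0 [s0s t0t cst]]].
have [A' AA As0] := rank_hit w1 (olt_le_trans s0s sA).
have [B' BB Bt0] := rank_hit w2 (olt_le_trans t0t tB).
have /rsubP[C cC [AE nAC]] := AA; have /rsubP[D cD [BE nBD]] := BB.
pose E := p @^-1` C `|` q @^-1` D.
have lt : rsub (box A B `&` E) (box A B).
  apply: rsubIP; first by apply: closedU; [exact: closed_fst|exact: closed_snd].
  move=> sub.
  have [x [Ax nCx]] : exists x, A x /\ ~ C x.
    apply: contrapT => h; apply: nAC => x Ax; apply: contrapT => nCx.
    by apply: h; exists x.
  apply: nBD => y By; have [w [wx wy]] := product_pair pq x y.
  by have [||] := sub w; rewrite /box /= ?wx ?wy.
apply: (ole_lt_trans _ (rank_rsub wT lt)).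
have := rank_supermodular (box A B) wT (closed_fst cC) (closed_snd cD).
have -> : box A B `&` p @^-1` C = box A' B.
  by rewrite AE /box preimage_setI setIAC.
have -> : box A B `&` q @^-1` D = box A B'.
  by rewrite BE /box preimage_setI setIA.
have -> : box A B `&` (p @^-1` C `&` q @^-1` D) = box A' B'.
  by rewrite AE BE /box !preimage_setI setIACA.
have up : rank (box A' B') <=o hmul s0 t0.
  by apply: rank_box_le; rewrite ?As0 ?Bt0.
have low1 : hmul s0 t <=o rank (box A' B) by apply: IHA => //; rewrite As0.
have low2 : hmul s t0 <=o rank (box A B') by apply: IHB => //; rewrite Bt0.
move=> sm; apply: (@hadd_cancel _ _ (hmul s0 t0)).
apply: ole_trans cst _; apply: ole_trans (hadd_mono low1 low2) _.
by apply: ole_trans sm _; exact: hadd_mono.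
Qed.

(** Ordinals are only determined up to =o, and nmul is defined from chosen
    normal forms; letting a and b vary in their classes makes the product
    compatible with =o on the ordinals that occur here. *)
Lemma rank_product a b : a =o rank [set: T1] -> b =o rank [set: T2] ->
  rank [set: T] =o nmul a b.
Proof.
move=> aT bT; rewrite nmul_hmul.
have -> : [set: T] = box setT setT by rewrite /box !preimage_setT setIT.
by split; [apply: rank_box_le|apply: rank_box_ge]; rewrite cnfP ?aT ?bT.
Qed.

End products.

Lemma is_product_inverse (T T1 T2 : topologicalType) (p : T -> T1) (q : T -> T2)
    (g : T1 * T2 -> T) :
    continuous p -> continuous q -> continuous g ->
    (forall xy, (p (g xy), q (g xy)) = xy) -> (forall w, g (p w, q w) = w) ->
  is_product p q.
Proof.
move=> cp cq cg pqg gpq; split=> // [x y|U w oU Uw].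
  by exists (g (x, y)); have [] := pqg (x, y).
have [|[A B] /= [nA nB] sub] := cg (p w, q w) U.
  by rewrite gpq; exact: open_nbhs_nbhs.
exists (interior A), (interior B).
split; [exact: open_interior|exact: open_interior|done|done|].
move=> v /interior_subset Av /interior_subset Bv.
by rewrite -[v]gpq; exact: (sub (p v, q v)).
Qed.

(** * Stature *)

Lemma rsub_hoare (T : topologicalType) (C D : hoare T) :
  hoare_lt D C <-> rsub (sval D) (sval C).
Proof.
case: C D => [C cC] [D cD]; rewrite /hoare_lt /=; split=> [[CD DC]|].
  split; first by move=> E; apply: DC; rewrite E.
  by exists D => //; exact/esym/setIidPr.
move=> /rsubP[E cE [-> nCE]]; split; first exact: subIsetl.
by move=> h; apply: nCE => x /h[].
Qed.

Lemma closed_rsub (T : topologicalType) (R S : set T) :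
  closed S -> rsub R S -> closed R.
Proof. by move=> cS [_ [C cC ->]]; exact: closedI. Qed.

Lemma noetherian_dcc (T : topologicalType) : noetherian T -> dcc T.
Proof.
move=> /noetherian_wf wf; apply: dcc_setT.
suff h (C : hoare T) : Acc (@rsub T) (sval C) by exact: (h (exist _ _ closedT)).
elim/(well_founded_ind wf): C => -[C cC] IH /=; constructor => R RC.
have cR := closed_rsub cC RC.
by apply: (IH (exist _ R cR)); exact/rsub_hoare.
Qed.

Lemma dcc_hoare_wf (T : topologicalType) : dcc T -> well_founded (@hoare_lt T).
Proof.
move=> wf -[C cC]; elim/(well_founded_ind wf): C cC => C IH cC.
by constructor => -[D cD] /rsub_hoare DC; exact: IH.
Qed.

Lemma stature_rank (T : topologicalType) : dcc T -> stature T =o rank [set: T].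
Proof.
move=> wf; have hwf := dcc_hoare_wf wf.
have rkC (C : hoare T) : rk (@hoare_lt T) C =o rank (sval C).
  elim/(well_founded_ind hwf): C => C IH; rewrite (rkE _ hwf); split.
    apply/oleP => -[D DC] /=; apply: ole_lt_trans (proj1 (IH _ DC)) _.
    by apply: rank_rsub => //; exact/rsub_hoare.
  apply: (rank_leP wf) => R RC; have cR := closed_rsub (svalP C) RC.
  have RC' : hoare_lt (exist _ R cR) C by exact/rsub_hoare.
  apply: ole_lt_trans (proj2 (IH _ RC')) _.
  by exists (exist (fun D => hoare_lt D C) _ RC').
split; last by rewrite -(rkC (exist _ _ closedT)); exact: (osup_ub (rk _)).
by apply: osup_lub => C; rewrite [X in X <=o _]rkC; exact: rank_mono.
Qed.

(** * Images and preimages *)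

Lemma image_setIpreimage (T U : Type) (f : T -> U) (S : set T) (C : set U) :
  f @` (S `&` f @^-1` C) = f @` S `&` C.
Proof.
rewrite predeqE => y; split=> [[x [Sx Cx] <-]|[[x Sx <-] Cx]]; last by exists x.
by split=> //; exists x.
Qed.

Lemma Acc_rsub_image (T U : topologicalType) (f : T -> U) (S : set T) :
  continuous f -> Acc (@rsub T) S -> Acc (@rsub U) (f @` S).
Proof.
move=> cf; elim=> {}S _ IH; constructor => _ /rsubP[C cC [-> nC]].
rewrite -image_setIpreimage; apply: IH; apply: rsubIP.
  by apply: preimage_closed cC => x _; exact: cf.
by move=> sub; apply: nC => _ [x Sx <-]; exact: sub.
Qed.

Lemma rank_embedding (T U : topologicalType) (f : T -> U) (S : set T) :
    dcc T -> dcc U -> continuous f ->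
    (forall D, closed D -> exists2 C, closed C & f @^-1` C = D) ->
  rank (f @` S) =o rank S.
Proof.
move=> wT wU cf ef; split; elim/(well_founded_ind wT): S => S IH.
  apply: (rank_leP wU) => _ /rsubP[C cC [-> nC]].
  have lt : rsub (S `&` f @^-1` C) S.
    apply: rsubIP; first by apply: preimage_closed cC => x _; exact: cf.
    by move=> sub; apply: nC => _ [x Sx <-]; exact: sub.
  rewrite -image_setIpreimage; apply: ole_lt_trans (IH _ lt) _.
  exact: rank_rsub.
apply: (rank_leP wT) => R RS; apply: ole_lt_trans (IH _ RS) _.
move: RS => /rsubP[D cD [-> nD]]; have [C cC CD] := ef _ cD.
apply: rank_rsub => //; rewrite -CD image_setIpreimage; apply: rsubIP => //.
by rewrite -CD in nD; move=> sub; apply: nD => x Sx; apply: sub; exists x.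
Qed.

Lemma rank_preimage (T U : topologicalType) (f : T -> U) (S : set U) :
    dcc T -> dcc U -> continuous f -> (forall y, exists x, f x = y) ->
  rank S <=o rank (f @^-1` S).
Proof.
move=> wT wU cf sf; elim/(well_founded_ind wU): S => S IH.
apply: (rank_leP wU) => R RS; apply: ole_lt_trans (IH _ RS) _.
move: RS => /rsubP[C cC [-> nC]]; apply: rank_rsub => //.
rewrite preimage_setI; apply: rsubIP.
  by apply: preimage_closed cC => x _; exact: cf.
by move=> sub; apply: nC => y; have [x <-] := sf y => /sub.
Qed.

(** * Words of fixed length *)

Lemma continuous_wordn (T : topologicalType) (X : nat -> topologicalType) n
    (f : T -> wordn X n) :
  (forall i, continuous (fun x => f x i)) -> continuous f.
Proof.
move=> cf x; apply/cvg_sup => i A [_ [[B oB <-] Bfx sub]].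
by apply: filterS sub _; apply: (cf i x); exact: open_nbhs_nbhs.
Qed.

Lemma wordn_proj_continuous (X : nat -> topologicalType) n (i : 'I_n) :
  continuous (fun w : wordn X n => w i).
Proof. exact: (@proj_continuous _ (fun i : 'I_n => X i)). Qed.

Definition behead_word (X : nat -> topologicalType) n (w : wordn X n.+1) :
  wordn (fun i => X i.+1) n := fun i => w (@Ordinal n.+1 i.+1 (ltn_ord i)).

Definition cons_word (X : nat -> topologicalType) n
    (xw : X 0 * wordn (fun i => X i.+1) n) : wordn X n.+1 :=
  fun i => let: Ordinal m lt := i in
    match m return forall lt : (m < n.+1)%N, X m with
    | 0 => fun=> xw.1
    | m.+1 => fun lt => xw.2 (@Ordinal n m lt)
    end lt.

Lemma is_product_cons (X : nat -> topologicalType) n :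
  is_product (fun w : wordn X n.+1 => w ord0) (@behead_word X n).
Proof.
apply: (is_product_inverse (g := @cons_word X n)).
- exact: (@wordn_proj_continuous X n.+1 ord0).
- apply: continuous_wordn => i.
  exact: (@wordn_proj_continuous X n.+1 (@Ordinal n.+1 i.+1 (ltn_ord i))).
- apply: continuous_wordn => -[[|m] lt] xw; first exact: cvg_fst.
  apply: (@continuous_comp _ _ (X m.+1) snd
    (fun w : wordn (fun i => X i.+1) n => w (@Ordinal n m lt))).
    exact: cvg_snd.
  exact: (@wordn_proj_continuous (fun i => X i.+1) n (@Ordinal n m lt)).
- move=> [x w]; congr pair; apply: functional_extensionality_dep => -[m lt] /=.
  by rewrite /behead_word /=; congr (w (Ordinal _)); exact: bool_irrelevance.
- move=> w; apply: functional_extensionality_dep => -[[|m] lt] /=.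
    by congr (w (Ordinal _)); exact: bool_irrelevance.
  by rewrite /behead_word /=; congr (w (Ordinal _)); exact: bool_irrelevance.
Qed.

Lemma ord_last_eq n (i : 'I_n.+1) : ~ (i < n)%N -> n = i.
Proof.
by move=> /negP; rewrite -leqNgt => ni; apply/eqP; rewrite eqn_leq ni -ltnS /=.
Qed.

Definition rcons_word (X : nat -> topologicalType) n (wx : wordn X n * X n) :
    wordn X n.+1 :=
  fun i => match pselect (i < n)%N with
    | left lt => wx.1 (Ordinal lt)
    | right ge => eq_rect n X wx.2 i (ord_last_eq ge)
    end.

Lemma is_product_rcons (X : nat -> topologicalType) n :
  is_product (@belast_word X n) (fun w : wordn X n.+1 => w ord_max).
Proof.
apply: (is_product_inverse (g := @rcons_word X n)).
- apply: continuous_wordn => i.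
  exact: (@wordn_proj_continuous X n.+1 (widen_ord (leqnSn n) i)).
- exact: (@wordn_proj_continuous X n.+1 ord_max).
- apply: continuous_wordn => i; rewrite /rcons_word; case: pselect => [lt|ge].
    move=> wx; apply: (@continuous_comp _ _ (X i) fst
      (fun w : wordn X n => w (Ordinal lt))).
      exact: cvg_fst.
    exact: (@wordn_proj_continuous X n (Ordinal lt)).
  case: _ / (ord_last_eq ge) => wx; exact: cvg_snd.
- move=> [w x]; congr pair.
    apply: functional_extensionality_dep => i; rewrite /belast_word /rcons_word.
    case: pselect => [lt|[]]; last exact: (ltn_ord i).
    by case: i lt => m lt lt'; congr (w (Ordinal _)); exact: bool_irrelevance.
  rewrite /rcons_word /=; case: pselect => [lt|ge].
    by have := lt; rewrite ltnn.
  move: (@ord_last_eq n ord_max ge) => /= e.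
  by rewrite (eq_irrelevance e (erefl n)).
- move=> w; apply: functional_extensionality_dep => i; rewrite /rcons_word.
  case: pselect => [lt|ge].
    case: i lt => m lt lt'; rewrite /belast_word /widen_ord /=.
    by congr (w (Ordinal _)); exact: bool_irrelevance.
  case: i ge => m lt ge; move: (ord_last_eq ge) => /= e; move: lt ge.
  case: _ / e => lt ge /=; congr (w (Ordinal _)); exact: bool_irrelevance.
Qed.

Lemma rsub_subsingleton (T : topologicalType) (R S : set T) :
  (forall x y, S x -> S y -> x = y) -> rsub R S -> R = set0.
Proof.
move=> S1 /rsubP[C cC [-> nC]]; rewrite -subset0 => x [Sx Cx].
by apply: nC => y Sy; rewrite (S1 _ _ Sy Sx).
Qed.

Lemma Acc_rsub_subsingleton (T : topologicalType) (S : set T) :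
  (forall x y, S x -> S y -> x = y) -> Acc (@rsub T) S.
Proof.
move=> S1; constructor => R /(rsub_subsingleton S1) ->.
by constructor => Q /rsubP[C cC [-> []]]; exact: sub0set.
Qed.

Lemma rank_singleton (T : topologicalType) (S : set T) : dcc T ->
  (forall x y, S x -> S y -> x = y) -> S !=set0 -> rank S =o oone.
Proof.
move=> wf S1 S0; split; last by apply/ole1; exact: rank_gt0.
apply: (rank_leP wf) => R /(rsub_subsingleton S1) ->.
by rewrite (rank_set0 wf); apply/olt1.
Qed.

Lemma wordn0_eq (X : nat -> topologicalType) (v w : wordn X 0) : v = w.
Proof. by apply: functional_extensionality_dep => -[]. Qed.

Lemma dcc_wordn (X : nat -> topologicalType) n :
  (forall i, dcc (X i)) -> dcc (wordn X n).
Proof.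
move=> dX; elim: n => [|n IH].
  apply: dcc_setT; apply: Acc_rsub_subsingleton => v w _ _.
  exact: wordn0_eq.
exact: dcc_product (is_product_rcons X n) IH (dX n).
Qed.

Lemma nprodS (a : nat -> ord) n :
  nprod a n.+1 = nmul (a 0) (nprod (fun i => a i.+1) n).
Proof. by rewrite /nprod big_ord_recl. Qed.

(** Iterated products associate to the right, hence the induction peels off the
    first letter, for all sequences of letter spaces at once. *)
Lemma rank_wordn (X : nat -> topologicalType) n : (forall i, dcc (X i)) ->
  rank [set: wordn X n] =o nprod (fun i => stature (X i)) n.
Proof.
elim: n X => [|n IH] X dX.
  rewrite /nprod big_ord0; apply: rank_singleton; first exact: dcc_wordn.
    by move=> v w _ _; exact: wordn0_eq.
  by exists (fun i : 'I_0 =>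
    match i with Ordinal m lt => False_rect _ (notF lt) end).
have dX' i : dcc (X i.+1) by exact: dX.
have h := rank_product (is_product_cons X n) (dX 0) (dcc_wordn (n := n) dX')
  (stature_rank (dX 0)) (oeq_sym (IH _ dX')).
rewrite nprodS; exact: h.
Qed.

(** Peeling off the last letter gives the other recurrence, without the
    associativity of nmul. *)
Lemma rank_wordnS (X : nat -> topologicalType) n : (forall i, dcc (X i)) ->
  rank [set: wordn X n.+1] =o nmul (rank [set: wordn X n]) (stature (X n)).
Proof.
move=> dX; exact: (rank_product (is_product_rcons X n) (dcc_wordn (n := n) dX)
  (dX n) (oeq_refl _) (stature_rank (dX n))).
Qed.

(** * Heterogeneous words *)

Lemma HWord_continuous (X : nat -> topologicalType) n :
  continuous (@HWord X n).
Proof.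
apply/continuousP => A [->|[U [[oU _] _] ->]]; first exact: open0.
exact: oU.
Qed.

Definition shorter (X : nat -> topologicalType) n : set (hword X) :=
  [set w | (hlen w < n)%N].

Lemma closed_shorter (X : nat -> topologicalType) n : closed (@shorter X n).
Proof.
rewrite -openC; right; exists (fun m => [set w : wordn X m | (n <= m)%N]).
  split; last first.
    by exists n; rewrite -subTset => w _ /=.
  split=> m; last by move=> w /= /leq_trans; apply.
  have [nm|nm] := boolP (n <= m)%N.
    rewrite (_ : [set _ | _] = setT); first exact: openT.
    by rewrite -subTset.
  rewrite (_ : [set _ | _] = set0); first exact: open0.
  by rewrite -subset0.
rewrite predeqE => w; rewrite /tfloor /shorter /=.
by split=> [/negP|h]; rewrite -?leqNgt // => /leq_trans/(_ h); rewrite ltnn.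
Qed.

(** Words shorter than n together with D form a closed set; its complement is
    the telescope that is empty before n and full after n. *)
Lemma HWord_closed (X : nat -> topologicalType) n (D : set (wordn X n)) :
  closed D -> exists2 C, closed C & @HWord X n @^-1` C = D.
Proof.
move=> cD.
pose U m := [set w : wordn X m | (n < m)%N \/
  exists e : m = n, ~ D (eq_rect m (wordn X) w n e)].
have Un : U n = ~` D.
  rewrite predeqE => w; split=> [[|[e]]|nD]; first by rewrite ltnn.
    by rewrite (eq_irrelevance e (erefl n)).
  by right; exists (erefl n).
exists (~` tfloor U); last first.
  have -> : @HWord X n @^-1` (~` tfloor U) = ~` U n by [].
  by rewrite Un setCK.
rewrite closedC; right; exists U => //; split; last first.
  by exists n.+1; rewrite -subTset => w _; left.
split=> m; last first.
  by move=> w [h|[e _]]; left; [exact: ltnW|rewrite -e].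
case: (ltngtP m n) => [mn|nm|->].
- rewrite (_ : U m = set0); first exact: open0.
  rewrite -subset0 => w [nm|[e _]].
    by have := ltn_trans mn nm; rewrite ltnn.
  by exfalso; move: mn; rewrite e ltnn.
- rewrite (_ : U m = setT); first exact: openT.
  by rewrite -subTset => w _; left.
- by rewrite Un; exact: closed_openC.
Qed.

(** This is where the telescopes have to be wide. *)
Lemma closed_hword_shorter (X : nat -> topologicalType) (C : set (hword X)) :
  closed C -> C <> setT -> exists n, C `<=` @shorter X n.
Proof.
move=> /closed_openC [C0|[U [tU [n Un]] CU]] CT.
  by case: CT; rewrite -(setCK C) C0 setC0.
exists n => w Cw; rewrite /shorter /= ltnNge; apply/negP => nw.
suff : (~` C) w by [].
by rewrite CU /tfloor /= (telescope_wide tU nw Un).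
Qed.

Lemma shorterS (X : nat -> topologicalType) n :
  @shorter X n.+1 = @shorter X n `|` range (@HWord X n).
Proof.
rewrite predeqE => -[m w]; rewrite /shorter /= ltnS; split.
  rewrite leq_eqVlt => /orP[/eqP mn|]; last by left.
  by right; case: _ / mn; exists w.
by case=> [/ltnW//|[v _ /(congr1 (@hlen X)) /= <-]].
Qed.

Lemma dcc_hword (X : nat -> topologicalType) :
  (forall i, dcc (X i)) -> dcc (hword X).
Proof.
move=> dX; have accn n : Acc (@rsub (hword X)) (@shorter X n).
  elim: n => [|n IH].
    by apply: Acc_rsub_subsingleton => -[m w].
  rewrite shorterS; apply: Acc_rsub_setU; first exact: IH.
  exact: Acc_rsub_image (@HWord_continuous X n) (dcc_wordn (n := n) dX setT).
apply: dcc_setT; constructor => S ST.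
have [n] := closed_hword_shorter (closed_rsub closedT ST) (proj1 ST).
exact: Acc_rsub_subset.
Qed.

Section rank_of_words.
Variable X : nat -> topologicalType.
Hypothesis dX : forall i, dcc (X i).
Let dH : dcc (hword X) := dcc_hword dX.

Let P n := rank [set: wordn X n].

Lemma rank_HWord n : rank (range (@HWord X n)) =o P n.
Proof.
exact: (rank_embedding setT (dcc_wordn (n := n) dX) dH (@HWord_continuous X n)
  (@HWord_closed X n)).
Qed.

Lemma rank_shorterS_le n :
  rank (@shorter X n.+1) <=o rank (@shorter X n) +h P n.
Proof. by rewrite shorterS -rank_HWord; exact: rank_setU. Qed.

Lemma rank_shorterS_ge n :
  oadd (rank (@shorter X n)) (P n) <=o rank (@shorter X n.+1).
Proof.
have := rank_closed_add (@shorter X n.+1) dH (@closed_shorter X n).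
apply: ole_trans; rewrite -rank_HWord; apply: oadd_mono; apply: rank_mono => //.
  by move=> w lt; split=> //; exact: leqW.
by move=> _ [w _ <-]; split; rewrite /shorter /= ?ltnn.
Qed.

Lemma rank_shorter_lt_opow n c : (forall i, (i < n)%N -> P i <o opow c) ->
  rank (@shorter X n) <o opow c.
Proof.
elim: n => [_|n IH Pc].
  suff -> : @shorter X 0 = set0 by rewrite (rank_set0 dH).
  by rewrite -subset0.
apply: ole_lt_trans (rank_shorterS_le n) _; apply: opow_closedP; last exact: Pc.
by apply: IH => i /leqW; exact: Pc.
Qed.

Lemma rank_hword_leP c : (forall n, rank (@shorter X n) <o c) ->
  rank [set: hword X] <=o c.
Proof.
move=> h; apply: (rank_leP dH) => S ST.
have [n sub] := closed_hword_shorter (closed_rsub closedT ST) (proj1 ST).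
exact: ole_lt_trans (rank_mono dH sub) (h n).
Qed.

Hypothesis X_nonempty : forall n, [set: X n] !=set0.

Lemma rank_wordn_mono m n : (m <= n)%N -> P m <=o P n.
Proof.
move=> /subnK <-; elim: (n - m)%N => [|k IH]; first by [].
apply: ole_trans IH _.
have pr := is_product_rcons X (k + m).
have := rank_preimage [set: wordn X (k + m)] (dcc_wordn (n := (k + m).+1) dX)
  (dcc_wordn (n := k + m) dX) (product_fst pr).
rewrite preimage_setT; apply => w; have [x _] := X_nonempty (k + m).
by have [v [<- _]] := product_pair pr w x; exists v.
Qed.

Lemma rank_wordn_gt0 n : ozero <o P n.
Proof.
apply: olt_le_trans (rank_wordn_mono (leq0n n)); rewrite /P.
by rewrite (rank_wordn 0 dX) /nprod big_ord0; apply/ole1.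
Qed.

End rank_of_words.

Theorem theorem13p8 (X : nat -> topologicalType)
    (X_nonempty : forall n : nat, [set: X n] !=set0)
    (X_noetherian : forall n : nat, noetherian (X n)) :
  (infinite_set [set n : nat | ~ ofinite (stature (X n))] ->
    stature (hword X) =o infinite_nprod (fun n => stature (X n)))
  /\
  ((\forall n \near \oo, ofinite (stature (X n))) ->
    forall k : nat, last_infinite (fun n => stature (X n)) k ->
      stature (hword X) =o omul (nprod (fun n => stature (X n)) k) omega).
Proof.
have dX n : dcc (X n) by exact: noetherian_dcc.
have dH := dcc_hword dX.
pose P n := rank [set: wordn X n].
have PE n : P n =o nprod (fun n => stature (X n)) n := rank_wordn n dX.
have PS n : P n.+1 =o nmul (P n) (stature (X n)) := rank_wordnS n dX.
have sH : stature (hword X) =o rank [set: hword X] := stature_rank dH.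
have subT n : rank (@shorter X n) <=o rank [set: hword X] by exact: rank_mono.
split=> [inf|_ k lastk]; rewrite sH; split.
- apply: (rank_hword_leP dX) => n.
  have [m nm infm] : exists2 m, (n <= m)%N & ~ ofinite (stature (X m)).
    apply: contrapT => h; apply: inf.
    apply: sub_finite_set (finite_II n) => m im.
    by rewrite /= ltnNge; apply/negP => nm; apply: h; exists m.
  have [e [_ eP Pe]] := leading_exponent (rank_wordn_gt0 dX X_nonempty n).
  apply: (@olt_le_trans (opow (osucc e))).
    apply: (rank_shorter_lt_opow dX) => i /ltnW ni.
    exact: ole_lt_trans (rank_wordn_mono dX X_nonempty ni) Pe.
  apply: ole_trans (osup_ub _ m.+1); rewrite -PE PS.
  apply: nmul_infinite_ge infm.
  exact: ole_trans eP (rank_wordn_mono dX X_nonempty nm).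
- apply: osup_lub => n; rewrite -PE.
  apply: ole_trans (subT n.+1); apply: ole_trans (rank_shorterS_ge dX n).
  exact: oadd_ge_r.
- have fin n : (k <= n)%N -> ofinite (stature (X n)).
    by case: lastk => [[_ f] _|[j [-> _ f]]]; [exact: f|exact: f].
  have [e [_ eP Pe]] := leading_exponent (rank_wordn_gt0 dX X_nonempty k).
  have Pn n : P n <o opow (osucc e).
    have [nk|/ltnW kn] := leqP n k.
      exact: ole_lt_trans (rank_wordn_mono dX X_nonempty nk) Pe.
    rewrite -(subnK kn); elim: (n - k)%N => [//|i IH].
    rewrite addSn PS; apply: nmul_finite_lt IH _.
    by apply: fin; exact: leq_addl.
  apply: (@ole_trans (opow (osucc e))); last first.
    by rewrite opowS; apply: omul_mono; rewrite -PE.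
  apply: (rank_hword_leP dX) => n.
  exact: (rank_shorter_lt_opow dX (fun i _ => Pn i)).
- apply: ole_trans (omul_mono _ (proj2 (PE k))) _; apply/omul_omegaP => n.
  apply: ole_trans (subT (n + k)).
  elim: n => [|n IH]; first by rewrite omul_nat0.
  rewrite omul_natS addSn; apply: ole_trans (rank_shorterS_ge dX (n + k)).
  apply: oadd_mono IH _.
  by apply: (rank_wordn_mono dX X_nonempty); exact: leq_addl.
Qed.
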